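(* Let $N\ge 2$ agents cooperatively solve $\min_{x\in\mathbb{R}^p} f(x):=\frac1N\sum_{i=1}^N f_i(x)$, where each $f_i:\mathbb{R}^p\to\mathbb{R}$ is twice differentiable and satisfies $\mu I_p\preceq \nabla^2 f_i(x)\preceq L I_p$ for all $x\in\mathbb{R}^p$, and $\|\nabla f_i(x)-\nabla f_i(y)\|\le L\|x-y\|$ for all $x,y$, with constants $0<\mu<L$; let $\kappa:=L/\mu>1$ and let $x^\ast$ be the minimizer of $f$. Let $W=[w_{ij}]\in\mathbb{R}^{N\times N}$ be a nonnegative doubly stochastic matrix with $w_{ii}>0$ for all $i$, and set $\varsigma:=\|W-I_N\|_2$, $\sigma:=\|W-\frac1N\mathbf{1}\mathbf{1}^\top\|_2$, assumed to satisfy $\sigma<1$, and $\bar\sigma:=1-\sigma$. Consider the algorithm (with step-size $\alpha>0$ and momentum coefficient $\beta>0$) described in the context, with error vector $\mathbf{e}(t)=(e_1(t),e_2(t),e_3(t),e_4(t))$ as defined there. Let $\epsilon=(\epsilon_1,\epsilon_2,\epsilon_3,\epsilon_4)$ with $\epsilon_i>0$ for each $i\in\{1,2,3,4\}$ be such that $$0<\epsilon_1<\min\Big\{\frac{\bar\sigma\epsilon_2}{L\varsigma},\ \frac{\epsilon_3}{\kappa^2}-\frac{\epsilon_2}{\mu\kappa},\ \frac{\epsilon_4}{\varsigma}\Big\}.$$ Define $\tilde\epsilon:=\kappa(\epsilon_1+\epsilon_3)+\frac{\epsilon_2}{\mu}$ and $\bar\epsilon:=L\kappa(\epsilon_1+\epsilon_3)+\kappa\epsilon_2$.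 If $(\alpha,\beta)$ satisfy $$0<\alpha<\min\Big\{\frac1\kappa,\ \frac{\bar\sigma\epsilon_1}{\tilde\epsilon},\ \frac{\bar\sigma\epsilon_2-L\varsigma\epsilon_1}{\bar\epsilon},\ \frac{\epsilon_4-\varsigma\epsilon_1}{\tilde\epsilon}\Big\},$$ $$0<\beta<\min\Big\{\frac{\tilde\epsilon}{\epsilon_4}\Big(\frac{\bar\sigma\epsilon_1}{\tilde\epsilon}-\alpha\Big),\ \frac{\bar\epsilon}{L\epsilon_4}\Big(\frac{\bar\sigma\epsilon_2-L\varsigma\epsilon_1}{\bar\epsilon}-\alpha\Big),\ \frac{\alpha}{\epsilon_4}\Big(\frac{\epsilon_3}{\kappa}-\kappa\epsilon_1-\frac{\epsilon_2}{\mu}\Big),\ \frac{\tilde\epsilon}{\epsilon_4}\Big(\frac{\epsilon_4-\varsigma\epsilon_1}{\tilde\epsilon}-\alpha\Big)\Big\},$$ then the spectral radius of the matrix $$A(\alpha,\beta)=\begin{pmatrix}\sigma+\alpha\kappa & \frac{\alpha}{\mu} & \alpha\kappa & \beta\\ L(\varsigma+\alpha\kappa) & \sigma+\alpha\kappa & L\alpha\kappa & L\beta\\ \alpha\kappa & \frac{\alpha}{\mu} & 1-\frac{\alpha}{\kappa} & \beta\\ \varsigma+\alpha\kappa & \frac{\alpha}{\mu} & \alpha\kappa & \beta\end{pmatrix}$$ satisfies $\rho(A(\alpha,\beta))<1$, and for every initialization, $\mathbf{e}(t)\to 0$ as $t\to\infty$ at a linear rate $O\big(\rho(A(\alpha,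\beta))^t\big)$.
   Context: Algorithm (for $t=0,1,2,\dots$, at each agent $i$, with $\mathcal{N}_i=\{j\neq i: w_{ij}>0\}$): $x_i(t+1)=\sum_{j\in\mathcal{N}_i\cup\{i\}} w_{ij}x_j(t)-\alpha d_i(t)+\beta v_i(t)$; $g_i(t+1)=\nabla f_i(x_i(t+1))-\nabla f_i(x_i(t))$; $y_i(t+1)=\sum_{j\in\mathcal{N}_i\cup\{i\}}w_{ij}y_j(t)+g_i(t+1)$; $v_i(t+1)=x_i(t+1)-x_i(t)$; $d_i(t)=[\nabla^2 f_i(x_i(t))]^{-1}y_i(t)$; initialized with arbitrary $x_i(0)$, $y_i(0)=\nabla f_i(x_i(0))$, $v_i(0)=0$ (i.e. $x_i(-1)=x_i(0)$). Matrix notation: $X(t),Y(t),V(t),D(t)\in\mathbb{R}^{N\times p}$ have $i$-th rows $x_i(t)^\top, y_i(t)^\top, v_i(t)^\top, d_i(t)^\top$; $\mathbf{1}\in\mathbb{R}^N$ is the all-ones vector; $\bar x(t)=\frac1N\mathbf{1}^\top X(t)$, $\bar y(t)=\frac1N\mathbf{1}^\top Y(t)$ (row vectors). Vector norms are Euclidean, matrix norms $\|\cdot\|$ are Frobenius, $\|\cdot\|_2$ is the spectral norm, $\rho(\cdot)$ the spectral radius. Errors: $e_1(t)=\|X(t)-\mathbf{1}\bar x(t)\|$, $e_2(t)=\|Y(t)-\mathbf{1}\bar y(t)\|$, $e_3(t)=\sqrt N\|\bar x(t)^\top-x^\ast\|$, $e_4(t)=\|X(t)-X(t-1)\|$. 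*)

(* Defs.v *)
From HB Require Import structures.
From mathcomp Require Import all_boot all_order all_algebra.
From mathcomp Require Import all_classical all_reals all_analysis.
From mathcomp Require Import complex.
Set Implicit Arguments. Unset Strict Implicit. Unset Printing Implicit Defensive.
Import Order.TTheory GRing.Theory Num.Theory.
Import numFieldNormedType.Exports.
Local Open Scope classical_set_scope.
Local Open Scope ring_scope.

Section Defs.
Variable R : realType.

Definition fro (m n : nat) (A : 'M[R]_(m, n)) : R :=
  Num.sqrt (\sum_(i < m) \sum_(j < n) A i j ^+ 2).

Definition spec_norm (m n : nat) (A : 'M[R]_(m, n)) : R :=
  sup [set r : R | exists v : 'cV[R]_n, fro v <= 1 /\ r = fro (A *m v)].

Definition spectral_radius (n : nat) (A : 'M[R]_n) : R :=
  sup [set r : R | exists z : R[i],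
         eigenvalue (map_mx (real_complex R) A) z /\ r = Normc.normc z].

Definition quad (p : nat) (H : 'M[R]_p) (v : 'rV[R]_p) : R := (v *m H *m v^T) 0 0.

Definition mixing_matrix (N : nat) (W : 'M[R]_N) : Prop :=
  (forall i j, 0 <= W i j) /\
  (forall i, \sum_(j < N) W i j = 1) /\
  (forall j, \sum_(i < N) W i j = 1) /\
  (forall i, 0 < W i i).

Section Algo.
Variables (N p : nat).
Variables (W : 'M[R]_N) (alpha beta : R).
Variable grad : 'I_N -> 'rV[R]_p -> 'rV[R]_p.
Variable hess : 'I_N -> 'rV[R]_p -> 'M[R]_p.
Variable X0 : 'M[R]_(N, p).

Definition Gmat (X : 'M[R]_(N, p)) : 'M[R]_(N, p) :=
  \matrix_(i, k) grad i (row i X) 0 k.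

Definition Dmat (X Y : 'M[R]_(N, p)) : 'M[R]_(N, p) :=
  \matrix_(i, k) ((invmx (hess i (row i X)) *m (row i Y)^T)^T) 0 k.

(* state t = (X(t), X(t-1), Y(t)), with X(-1) = X(0), Y(0) = grad(X(0)).
   V(t) = X(t) - X(t-1). *)
Fixpoint state (t : nat) : 'M[R]_(N, p) * 'M[R]_(N, p) * 'M[R]_(N, p) :=
  match t with
  | 0 => (X0, X0, Gmat X0)
  | t'.+1 =>
      let: (X, Xp, Y) := state t' in
      let X' := W *m X - alpha *: Dmat X Y + beta *: (X - Xp) in
      (X', X, W *m Y + (Gmat X' - Gmat X))
  end.

Definition Xs t := (state t).1.1.
Definition Xprev t := (state t).1.2.
Definition Ys t := (state t).2.

Definition avg (M : 'M[R]_(N, p)) : 'rV[R]_p :=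
  (N%:R)^-1 *: (const_mx 1 : 'rV[R]_N) *m M.
Definition consensus (M : 'M[R]_(N, p)) : 'M[R]_(N, p) :=
  (const_mx 1 : 'cV[R]_N) *m avg M.

Definition e1 (t : nat) : R := fro (Xs t - consensus (Xs t)).
Definition e2 (t : nat) : R := fro (Ys t - consensus (Ys t)).
Definition e3 (xstar : 'rV[R]_p) (t : nat) : R :=
  Num.sqrt (N%:R) * fro (avg (Xs t) - xstar).
Definition e4 (t : nat) : R := fro (Xs t - Xprev t).

Definition evec (xstar : 'rV[R]_p) (t : nat) : 'cV[R]_4 :=
  \col_(k < 4) [:: e1 t; e2 t; e3 xstar t; e4 t]`_k.
End Algo.

Definition Amat (mu L kappa vs sigma alpha beta : R) : 'M[R]_4 :=
  \matrix_(i < 4, j < 4)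
    (nth [::] [:: [:: sigma + alpha * kappa; alpha / mu; alpha * kappa; beta];
                  [:: L * (vs + alpha * kappa); sigma + alpha * kappa;
                      L * alpha * kappa; L * beta];
                  [:: alpha * kappa; alpha / mu; 1 - alpha / kappa; beta];
                  [:: vs + alpha * kappa; alpha / mu; alpha * kappa; beta]] i)`_j.

End Defs.

(* Main.v *)
Require Import Defs.
From HB Require Import structures.
From mathcomp Require Import all_boot all_order all_algebra.
From mathcomp Require Import all_classical all_reals all_analysis.
From mathcomp Require Import complex ring lra.
Set Implicit Arguments. Unset Strict Implicit. Unset Printing Implicit Defensive.
Import Order.TTheory GRing.Theory Num.Theory.
Import numFieldNormedType.Exports.
Local Open Scope classical_set_scope.
Local Open Scope ring_scope.

(** Let [G] be the norm of the gradient of the mean objective [F] at the mean iterate,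
    scaled by [sqrt N / mu], and let [k] be the square root of the condition number.
    The consensus, tracking and difference errors obey the corresponding rows of
    [Amat], with [G] in place of [kappa e3].  The optimality error, however, is not
    contracted in the Euclidean norm by [x |-> x - alpha P(x) grad F(x)], where [P(x)] is
    the mean of the inverse Hessians: in dimension at least 2 the product of two positive
    definite matrices can have an indefinite symmetric part.  It is therefore replaced by
    [phi], the square root of [2 N (F - min F) / mu], which dominates [e3].  This costs a
    factor [k] in the influence of the other errors on [phi], but [phi <= G <= k phi] and
    [phi ^ 2] decreases by a multiple of [G ^ 2], so a large feedback of [G] into the
    other rows comes with a fast decrease of [phi].  Let [l] be a positive left Perron
    eigenvector of [Amat].  Then [l1 e1 + l2 e2 + (l3 / k) phi + l4 e4] is multiplied by
    at most [rho] at each step; pairing [l] with [eps] gives [rho < 1]. *)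

(** * Frobenius and spectral norms *)

Section Frobenius.
Variable R : realType.

Definition frodot (m n : nat) (A B : 'M[R]_(m, n)) : R :=
  \sum_i \sum_j A i j * B i j.

Lemma frodotC m n (A B : 'M[R]_(m, n)) : frodot A B = frodot B A.
Proof. by apply: eq_bigr => i _; apply: eq_bigr => j _; rewrite mulrC. Qed.

Lemma frodotDl m n (A B C : 'M[R]_(m, n)) :
  frodot (A + B) C = frodot A C + frodot B C.
Proof.
rewrite -big_split; apply: eq_bigr => i _; rewrite -big_split.
by apply: eq_bigr => j _; rewrite mxE mulrDl.
Qed.

Lemma frodotZl m n a (A B : 'M[R]_(m, n)) : frodot (a *: A) B = a * frodot A B.
Proof.
rewrite mulr_sumr; apply: eq_bigr => i _; rewrite mulr_sumr.
by apply: eq_bigr => j _; rewrite mxE mulrA.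
Qed.

Lemma frodotDr m n (A B C : 'M[R]_(m, n)) :
  frodot C (A + B) = frodot C A + frodot C B.
Proof. by rewrite frodotC frodotDl !(frodotC _ C). Qed.

Lemma frodotZr m n a (A B : 'M[R]_(m, n)) : frodot B (a *: A) = a * frodot B A.
Proof. by rewrite frodotC frodotZl frodotC. Qed.

Lemma frodotNl m n (A B : 'M[R]_(m, n)) : frodot (- A) B = - frodot A B.
Proof. by rewrite -scaleN1r frodotZl mulN1r. Qed.

Lemma frodotNr m n (A B : 'M[R]_(m, n)) : frodot B (- A) = - frodot B A.
Proof. by rewrite frodotC frodotNl frodotC. Qed.

Lemma frodot0l m n (A : 'M[R]_(m, n)) : frodot 0 A = 0.
Proof. by rewrite -[0](scale0r A) frodotZl mul0r. Qed.

Lemma frodot_suml m n (I : Type) (r : seq I) (F : I -> 'M[R]_(m, n)) A :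
  frodot (\sum_(i <- r) F i) A = \sum_(i <- r) frodot (F i) A.
Proof.
apply: (big_morph (fun B => frodot B A)) => [B C|]; first exact: frodotDl.
exact: frodot0l.
Qed.

Lemma frodot_trmx p (u v : 'rV[R]_p) : (u *m v^T) 0 0 = frodot u v.
Proof. by rewrite mxE /frodot big_ord1; apply: eq_bigr => j _; rewrite mxE. Qed.

Lemma fro_sqr m n (A : 'M[R]_(m, n)) : fro A ^+ 2 = frodot A A.
Proof.
rewrite sqr_sqrtr; last by apply: sumr_ge0 => i _; apply: sumr_ge0 => j _; rewrite sqr_ge0.
by apply: eq_bigr => i _; apply: eq_bigr => j _; rewrite expr2.
Qed.

Lemma fro_ge0 m n (A : 'M[R]_(m, n)) : 0 <= fro A.
Proof. exact: sqrtr_ge0. Qed.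

Lemma fro_eq0 m n (A : 'M[R]_(m, n)) : fro A = 0 -> A = 0.
Proof.
move=> A0; have : frodot A A == 0 by rewrite -fro_sqr A0 expr0n.
have AA i j : 0 <= A i j * A i j by rewrite -expr2 sqr_ge0.
rewrite psumr_eq0 => [/allP h|i _]; last exact: sumr_ge0.
apply/matrixP => i j; rewrite mxE; apply/eqP.
have := h i (mem_index_enum _); rewrite /= psumr_eq0 => [/allP/(_ j (mem_index_enum _))|//].
by rewrite /= mulf_eq0 orbb.
Qed.

Lemma fro0 m n : fro (0 : 'M[R]_(m, n)) = 0.
Proof. by apply/eqP; rewrite -(@sqrf_eq0 R) fro_sqr frodot0l. Qed.

Lemma fro_le_bound m n (A : 'M[R]_(m, n)) c :
  0 <= c -> frodot A A <= c ^+ 2 -> fro A <= c.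
Proof. by move=> c0; rewrite -fro_sqr ler_sqr // nnegrE fro_ge0. Qed.

(** Cauchy-Schwarz, by expanding the nonnegative square of [fro B *: A - fro A *: B]; zero norms are
    split off so that the product of the norms can be cancelled. *)
Lemma frodot_le_fro m n (A B : 'M[R]_(m, n)) : frodot A B <= fro A * fro B.
Proof.
have [B0|Bn0] := eqVneq (fro B) 0.
  by rewrite B0 mulr0 (fro_eq0 B0) frodotC frodot0l.
have [A0|An0] := eqVneq (fro A) 0.
  by rewrite A0 mul0r (fro_eq0 A0) frodot0l.
have Ap : 0 < fro A by rewrite lt0r An0 fro_ge0.
have Bp : 0 < fro B by rewrite lt0r Bn0 fro_ge0.
have : 0 <= frodot (fro B *: A - fro A *: B) (fro B *: A - fro A *: B).
  by rewrite -fro_sqr sqr_ge0.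
rewrite !(frodotDl, frodotDr, frodotNl, frodotNr, frodotZl, frodotZr) -!fro_sqr.
rewrite (frodotC B A) => h.
have {h} : fro A * fro B * frodot A B <= fro A * fro B * (fro A * fro B) by lra.
by rewrite ler_pM2l // mulr_gt0.
Qed.

Lemma fro_triangle m n (A B : 'M[R]_(m, n)) : fro (A + B) <= fro A + fro B.
Proof.
apply: fro_le_bound; first by rewrite addr_ge0 ?fro_ge0.
rewrite !(frodotDl, frodotDr) (frodotC B A) -!fro_sqr.
by have := frodot_le_fro A B; lra.
Qed.

Lemma froZ m n a (A : 'M[R]_(m, n)) : fro (a *: A) = `|a| * fro A.
Proof.
apply/eqP; rewrite -(@eqrXn2 _ 2) ?mulr_ge0 ?fro_ge0 //.
by rewrite exprMn !fro_sqr frodotZl frodotZr mulrA -expr2 real_normK ?num_real.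
Qed.

Lemma froN m n (A : 'M[R]_(m, n)) : fro (- A) = fro A.
Proof. by rewrite -scaleN1r froZ normrN1 mul1r. Qed.

Lemma frodot_rows m n (A B : 'M[R]_(m, n)) :
  frodot A B = \sum_i frodot (row i A) (row i B).
Proof.
apply: eq_bigr => i _; rewrite /frodot big_ord1.
by apply: eq_bigr => j _; rewrite !mxE.
Qed.

Lemma frodot_cols m n (A B : 'M[R]_(m, n)) :
  frodot A B = \sum_j frodot (col j A) (col j B).
Proof.
rewrite /frodot exchange_big; apply: eq_bigr => j _.
by apply: eq_bigr => i _; rewrite big_ord1 !mxE.
Qed.

Lemma fro_le_rows m n n' (A : 'M[R]_(m, n)) (B : 'M[R]_(m, n')) c :
  0 <= c -> (forall i, fro (row i A) <= c * fro (row i B)) -> fro A <= c * fro B.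
Proof.
move=> c0 h; apply: fro_le_bound; first by rewrite mulr_ge0 ?fro_ge0.
rewrite exprMn fro_sqr !frodot_rows mulr_sumr; apply: ler_sum => i _.
by rewrite -!fro_sqr -exprMn ler_sqr ?nnegrE ?mulr_ge0 ?fro_ge0.
Qed.

(** Cauchy-Schwarz for each entry of the product. Besides submultiplicativity, this is what bounds
    the set whose [sup] defines [spec_norm]. *)
Lemma fro_mulmx m n q (A : 'M[R]_(m, n)) (B : 'M[R]_(n, q)) :
  fro (A *m B) <= fro A * fro B.
Proof.
apply: fro_le_bound; first by rewrite mulr_ge0 ?fro_ge0.
rewrite exprMn !fro_sqr frodot_rows (frodot_cols B) (frodot_rows A) mulr_suml.
apply: ler_sum => i _; rewrite mulr_sumr /frodot big_ord1.
apply: ler_sum => j _; rewrite -!/(frodot _ _).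
have -> : row i (A *m B) 0 j = frodot (row i A) (col j B)^T.
  rewrite -frodot_trmx trmxK !mxE; apply: eq_bigr => k _.
  by rewrite !mxE.
have froT : fro (col j B)^T = fro (col j B).
  congr (Num.sqrt _); rewrite exchange_big; apply: eq_bigr => a _.
  by apply: eq_bigr => b _; rewrite mxE.
set x := frodot _ _.
have lx : x <= fro (row i A) * fro (col j B).
  by rewrite -froT; exact: frodot_le_fro.
have lnx : - x <= fro (row i A) * fro (col j B).
  by rewrite -frodotNl -(froN (row i A)) -froT; exact: frodot_le_fro.
rewrite -expr2 -!fro_sqr -exprMn -(real_normK (num_real x)).
rewrite ler_sqr ?nnegrE ?mulr_ge0 ?fro_ge0 //.
by rewrite ler_norml lx andbT lerNl.
Qed.

(** The [sup] dominates its set only once that set is known to be bounded, here by [fro A]; then [v]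
    is rescaled to a unit vector. *)
Lemma spec_norm_col m n (A : 'M[R]_(m, n)) (v : 'cV[R]_n) :
  fro (A *m v) <= spec_norm A * fro v.
Proof.
have ubA : has_ubound [set r | exists w : 'cV[R]_n, fro w <= 1 /\ r = fro (A *m w)].
  exists (fro A) => _ [w [w1 ->]]; apply: le_trans (fro_mulmx _ _) _.
  by rewrite ler_piMr ?fro_ge0.
have [v0|vn0] := eqVneq (fro v) 0.
  by rewrite (fro_eq0 v0) mulmx0 !fro0 mulr0.
have vp : 0 < fro v by rewrite lt0r vn0 fro_ge0.
rewrite -ler_pdivrMr // mulrC.
have -> : (fro v)^-1 * fro (A *m v) = fro (A *m ((fro v)^-1 *: v)).
  by rewrite -scalemxAr froZ gtr0_norm // invr_gt0.
apply: ub_le_sup => //; exists ((fro v)^-1 *: v); split=> //.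
by rewrite froZ gtr0_norm ?invr_gt0 // mulVf.
Qed.

Lemma spec_norm_ge0 m n (A : 'M[R]_(m, n)) : 0 <= spec_norm A.
Proof.
apply: ub_le_sup.
  exists (fro A) => _ [w [w1 ->]]; apply: le_trans (fro_mulmx _ _) _.
  by rewrite ler_piMr ?fro_ge0.
by exists 0; rewrite mulmx0 !fro0; split.
Qed.

Lemma spec_norm_mulmx m n q (A : 'M[R]_(m, n)) (B : 'M[R]_(n, q)) :
  fro (A *m B) <= spec_norm A * fro B.
Proof.
have s0 := spec_norm_ge0 A.
apply: fro_le_bound; first by rewrite mulr_ge0 ?fro_ge0.
rewrite exprMn fro_sqr !frodot_cols mulr_sumr; apply: ler_sum => j _.
rewrite -!fro_sqr -exprMn ler_sqr ?nnegrE ?mulr_ge0 ?fro_ge0 //.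
have -> : col j (A *m B) = A *m col j B by rewrite !colE mulmxA.
exact: spec_norm_col.
Qed.

End Frobenius.

(** * Smooth strongly convex functions *)

Lemma is_derive_line (R : realType) (V W : normedModType R) (F : V -> W) x v (t : R) :
  derivable F (x + t *: v) v ->
  is_derive t 1 (fun s : R => F (x + s *: v)) ('D_v F (x + t *: v)).
Proof.
move=> dF.
have E : (fun h : R => h^-1 *: (((fun s : R => F (x + s *: v)) \o shift t) (h *: 1) -
      F (x + t *: v))) =
    (fun h => h^-1 *: ((F \o shift (x + t *: v)) (h *: v) - F (x + t *: v))).
  apply/funext => h /=; congr (_ *: (F _ - _)).
  by rewrite scalerDl addrCA; congr (_ *: _ + _); rewrite /GRing.scale /= mulr1.
by split; rewrite /derivable /derive E.
Qed.

(** The mean value theorem applied to [h t - h' 0 * t - c / 2 * t ^+ 2], whose derivative is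
    nonnegative on the open unit interval. *)
Lemma taylor1_ge (R : realType) (h h' : R -> R) (c : R) :
  (forall t : R, is_derive t 1 h (h' t)) ->
  (forall t : R, 0 < t -> t < 1 -> c * t <= h' t - h' 0) ->
  h 0 + h' 0 + c / 2 <= h 1.
Proof.
move=> dh hc.
pose k t := h t - h' 0 * t - c / 2 * t ^+ 2.
have dk (t : R) : is_derive t 1 k (h' t - h' 0 - c * t).
  have dh't := dh t.
  apply: is_derive_eq.
  rewrite /GRing.scale /=. lra.
have [|t] := @MVT R k _ 0 1 ltr01 (fun s _ => dk s).
  apply: continuous_subspaceT => t; apply: differentiable_continuous.
  by apply/derivable1_diffP; case: (dk t).
rewrite in_itv /= => /andP[t0 t1].
have := hc t t0 t1; rewrite /k subr0 mulr1; nra.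
Qed.

Lemma cvg_frodot (R : realType) (m n : nat) (T : Type) (F : set_system T)
    (FF : Filter F) (u w : T -> 'M[R]_(m, n)) (a b : 'M[R]_(m, n)) :
  u x @[x --> F] --> a -> w x @[x --> F] --> b ->
  frodot (u x) (w x) @[x --> F] --> frodot a b.
Proof.
move=> ua wb; apply: cvg_big => [|i _]; first exact: add_continuous.
apply: cvg_big => [|j _]; first exact: add_continuous.
apply: cvgM.
  exact: (@cvg_comp _ _ _ u (fun M : 'M[R]_(m, n) => M i j) _ _ _ ua
    (@coord_continuous R m n i j a)).
exact: (@cvg_comp _ _ _ w (fun M : 'M[R]_(m, n) => M i j) _ _ _ wb
    (@coord_continuous R m n i j b)).
Qed.

Section Convex.
Variables (R : realType) (p : nat).
Variables (f : 'rV[R]_p -> R) (g : 'rV[R]_p -> 'rV[R]_p) (H : 'rV[R]_p -> 'M[R]_p).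
Variables (mu L : R).
Hypothesis fdiff : forall x, differentiable f x.
Hypothesis fgrad : forall x v, 'd f x v = (v *m (g x)^T) 0 0.
Hypothesis gdiff : forall x, differentiable g x.
Hypothesis ghess : forall x v, 'd g x v = v *m (H x)^T.
Hypothesis quad_ge : forall x v, mu * fro v ^+ 2 <= quad (H x) v.
Hypothesis gLip : forall x y, fro (g x - g y) <= L * fro (x - y).
Hypothesis mu_gt0 : 0 < mu.
Hypothesis L_gt0 : 0 < L.

Lemma quadE (A : 'M[R]_p) v : quad A v = frodot v (v *m A^T).
Proof. by rewrite -frodot_trmx trmx_mul trmxK mulmxA. Qed.

Lemma f_line x v (t : R) :
  is_derive t 1 (fun s : R => f (x + s *: v)) (frodot (g (x + t *: v)) v).
Proof.
have := @is_derive_line _ _ _ f x v t (diff_derivable (fdiff _)).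
by rewrite deriveE // fgrad frodot_trmx frodotC.
Qed.

Lemma grad_quotient_cvg x v :
  (fun h : R => h^-1 *: ((g \o shift x) (h *: v) - g x)) @ 0^' --> v *m (H x)^T.
Proof.
by rewrite -ghess -deriveE //; exact: (diff_derivable (gdiff x)).
Qed.

Lemma gv_line x v (t : R) :
  is_derive t 1 (fun s : R => frodot (g (x + s *: v)) v) (quad (H (x + t *: v)) v).
Proof.
pose G y := frodot (g y) v; set y := x + t *: v.
have cG : (fun h : R => h^-1 *: ((G \o shift y) (h *: v) - G y)) @ 0^'
          --> quad (H y) v.
  rewrite quadE frodotC.
  have -> : (fun h : R => h^-1 *: ((G \o shift y) (h *: v) - G y)) =
            (fun h => frodot (h^-1 *: ((g \o shift y) (h *: v) - g y)) v).
    by apply/funext => h; rewrite frodotZl frodotDl frodotNl.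
  by apply: cvg_frodot; [exact: grad_quotient_cvg|exact: cvg_cst].
have dG : derivable G y v by apply/cvg_ex; exists (quad (H y) v).
have := is_derive_line dG.
by rewrite /derive (cvg_lim _ cG).
Qed.

(** [taylor1_ge] along the segment; the growth of the directional derivative comes from a second
    mean value theorem, in which [quad_ge] bounds the slope. *)
Lemma strong_convexity x y :
  f x + frodot (g x) (y - x) + mu / 2 * fro (y - x) ^+ 2 <= f y.
Proof.
set v := y - x.
have := @taylor1_ge R (fun s => f (x + s *: v)) (fun s => frodot (g (x + s *: v)) v)
   (mu * fro v ^+ 2) (f_line x v).
rewrite scale0r scale1r addr0 /v [x + (y - x)]addrC subrK -/v => h.
rewrite mulrAC; apply: h => t t0 t1.
have dq (s : R) := gv_line x v s.
have [|s _] := @MVT R _ _ 0 t t0 (fun s _ => dq s).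
  apply: continuous_subspaceT => s; apply: differentiable_continuous.
  by apply/derivable1_diffP; case: (dq s).
rewrite scale0r addr0 => ->; rewrite subr0 ler_pM2r //; exact: quad_ge.
Qed.

(** [taylor1_ge] applied to [- f], with the Lipschitz bound on the gradient in place of second-order
    information. *)
Lemma descent x y :
  f y <= f x + frodot (g x) (y - x) + L / 2 * fro (y - x) ^+ 2.
Proof.
set v := y - x.
have := @taylor1_ge R (fun s => - f (x + s *: v)) (fun s => - frodot (g (x + s *: v)) v)
   (- (L * fro v ^+ 2)).
rewrite scale0r scale1r addr0 /v [x + (y - x)]addrC subrK -/v => h.
suff : - f x + - frodot (g x) v + - (L * fro v ^+ 2) / 2 <= - f y by lra.
apply: h => [t|t t0 t1]; first by have := f_line x v t => ?; exact: is_deriveN.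
suff : frodot (g (x + t *: v) - g x) v <= L * fro v ^+ 2 * t.
  by rewrite frodotDl frodotNl; lra.
apply: le_trans (frodot_le_fro _ _) _.
have := gLip (x + t *: v) x.
rewrite [x + _ - x]addrC addKr froZ (gtr0_norm t0) => /ler_wpM2r -/(_ _ (fro_ge0 v)).
by move=> /le_trans; apply; rewrite expr2; lra.
Qed.

(** Baillon-Haddad argument: at the point [z], a step of length [1 / L] from [b], the lower bound
    based at [a] is compared with the upper bound based at [b]. The resulting inequality [key] is
    added to its copy with the two points exchanged. *)
Lemma cocoercive x y :
  fro (g x - g y) ^+ 2 <= L * frodot (g x - g y) (x - y).
Proof.
have key a b : f a + frodot (g a) (b - a) + fro (g b - g a) ^+ 2 / (2 * L) <= f b.
  pose w := g b - g a; pose z := b - L^-1 *: w.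
  have h1 := strong_convexity a z; have h2 := descent b z.
  have zb : z - b = - (L^-1 *: w) by rewrite /z addrC addKr.
  have za : z - a = (b - a) - L^-1 *: w by rewrite /z addrAC.
  rewrite zb froN froZ exprMn real_normK ?num_real // frodotNr frodotZr in h2.
  have h3 : 0 <= mu / 2 * fro (z - a) ^+ 2.
    by rewrite mulr_ge0 ?sqr_ge0 // divr_ge0 ?ltW.
  rewrite {1}za frodotDr frodotNr frodotZr in h1.
  have ww : fro w ^+ 2 = frodot (g b) w - frodot (g a) w.
    by rewrite fro_sqr {1}/w frodotDl frodotNl.
  have L0 : L != 0 by rewrite gt_eqF.
  have -> : fro w ^+ 2 / (2 * L) =
     L^-1 * (frodot (g b) w - frodot (g a) w) - L / 2 * (L^-1 ^+ 2 * fro w ^+ 2).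
    by rewrite -ww; field.
  lra.
have h1 := key x y; have h2 := key y x.
rewrite -(opprB (g x)) froN -(opprB x) frodotNr in h1.
rewrite frodotDl frodotNl.
have : fro (g x - g y) ^+ 2 / L <= frodot (g x) (x - y) - frodot (g y) (x - y).
  have -> : fro (g x - g y) ^+ 2 / L = 2 * (fro (g x - g y) ^+ 2 / (2 * L)).
    by field; rewrite gt_eqF.
  lra.
by rewrite ler_pdivrMr // mulrC.
Qed.

(* Dividing the cocoercivity inequality at x and x + h v by h^2 and letting h tend to 0
   spares the symmetry of the Hessian. *)
Lemma hess_cocoercive x (v : 'rV[R]_p) :
  fro (v *m (H x)^T) ^+ 2 <= L * frodot (v *m (H x)^T) v.
Proof.
pose q (h : R) : 'rV[R]_p := h^-1 *: ((g \o shift x) (h *: v) - g x).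
have c : q h @[h --> 0^'] --> v *m (H x)^T by exact: grad_quotient_cvg.
have cv : L * frodot (q h) v - frodot (q h) (q h) @[h --> 0^'] -->
    L * frodot (v *m (H x)^T) v - frodot (v *m (H x)^T) (v *m (H x)^T).
  apply: cvgB; last exact: cvg_frodot.
  by apply: cvgMl_tmp; apply: cvg_frodot => //; exact: cvg_cst.
rewrite fro_sqr -subr_ge0; apply: cvgr_to_ge cv _.
near=> h.
have h0 : h != 0 by near: h; exact: nbhs_dnbhs_neq.
have /= := cocoercive (h *: v + x) x.
rewrite addrK fro_sqr frodotZr /q /= !(frodotZl, frodotZr) => co.
rewrite subr_ge0 -(@ler_pM2l _ (h ^+ 2)); last by rewrite exprn_even_gt0.
have -> a : h ^+ 2 * (h^-1 * (h^-1 * a)) = a by field.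
have -> a : h ^+ 2 * (L * (h^-1 * a)) = L * (h * a) by field.
exact: co.
Unshelve. all: by end_near. Qed.

Lemma hess_unitmx x : H x \in unitmx.
Proof.
rewrite -row_free_unit; apply: inj_row_free => v vH.
have := quad_ge x v; rewrite /quad vH mul0mx mxE => h.
apply: fro_eq0; apply/eqP; rewrite -sqrf_eq0 eq_le sqr_ge0 andbT.
by rewrite -(ler_pM2l mu_gt0) mulr0.
Qed.

Definition newton x (y : 'rV[R]_p) : 'rV[R]_p := (invmx (H x) *m y^T)^T.

Lemma newtonD x y z : newton x (y + z) = newton x y + newton x z.
Proof. by rewrite /newton linearD mulmxDr linearD. Qed.

Lemma newton_hess x y : newton x y *m (H x)^T = y.
Proof. by rewrite -trmx_mul mulKVmx ?hess_unitmx // trmxK. Qed.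

Lemma newton_dot_ge x y : mu * fro (newton x y) ^+ 2 <= frodot y (newton x y).
Proof.
by have := quad_ge x (newton x y); rewrite quadE newton_hess frodotC.
Qed.

(** The inverse Hessian is bounded below by [1 / L] as a quadratic form: [hess_cocoercive] at the
    Newton direction. *)
Lemma newton_dot_ge_grad x y : fro y ^+ 2 <= L * frodot y (newton x y).
Proof. by have := hess_cocoercive x (newton x y); rewrite newton_hess. Qed.

Lemma fro_newton x y : fro (newton x y) <= mu^-1 * fro y.
Proof.
have h := le_trans (newton_dot_ge x y) (frodot_le_fro _ _).
have [->|n0] := eqVneq (fro (newton x y)) 0.
  by rewrite mulr_ge0 ?fro_ge0 // invr_ge0 ltW.
have np : 0 < fro (newton x y) by rewrite lt0r n0 fro_ge0.
rewrite mulrC ler_pdivlMr // mulrC -(ler_pM2r np); move: h; rewrite expr2; lra.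
Qed.

End Convex.

(** * Perron vectors and the spectral radius *)

Section Perron.
Variables (R : realType) (n : nat) (A : 'M[R]_n.+1).
Hypothesis A_gt0 : forall i j, 0 < A i j.

Lemma mulmx_gt0 (x : 'rV[R]_n.+1) : (forall i, 0 <= x 0 i) -> x != 0 ->
  forall j, 0 < (x *m A) 0 j.
Proof.
move=> x0 /eqP xn0 j; rewrite mxE lt0r sumr_ge0 ?andbT; last first.
  by move=> i _; rewrite mulr_ge0 // ltW.
rewrite psumr_eq0 => [|i _]; last by rewrite mulr_ge0 // ltW.
apply/negP => /allP h; apply: xn0; apply/rowP => i; rewrite mxE.
have := h i (mem_index_enum _).
by rewrite /= mulf_eq0 (gt_eqF (A_gt0 i j)) orbF => /eqP.
Qed.

(** A compact set for the Collatz-Wielandt maximisation. The upper bound on the first component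
    excludes no candidate, as [cand_normalized] shows. *)
Let box : set (R * 'rV[R]_n.+1) :=
  `[0, \sum_j \sum_i A i j] `*` [set x : 'rV[R]_n.+1 | forall i, `[0, 1]%classic (x ord0 i)].

Let cand : set (R * 'rV[R]_n.+1) :=
  box `&` ([set u : R * 'rV[R]_n.+1 | \sum_i u.2 0 i = 1] `&`
           [set u : R * 'rV[R]_n.+1 | forall j, 0 <= (u.2 *m A) 0 j - u.1 * u.2 0 j]).

Let cont_coord i : continuous (fun u : R * 'rV[R]_n.+1 => u.2 0 i).
Proof.
move=> u; apply: (@continuous_comp _ _ _ snd (fun x : 'rV[R]_n.+1 => x 0 i)).
  exact: cvg_snd.
exact: coord_continuous.
Qed.

Let compact_cand : compact cand.
Proof.
have cbox : compact box.
  apply: compact_setX; first exact: segment_compact.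
  exact: (@rV_compact R n.+1 (fun=> `[0, 1]%classic) (fun=> @segment_compact R 0 1)).
have closed_cons : closed ([set u : R * 'rV[R]_n.+1 | \sum_i u.2 0 i = 1] `&`
           [set u : R * 'rV[R]_n.+1 | forall j, 0 <= (u.2 *m A) 0 j - u.1 * u.2 0 j]).
  apply: closedI.
    apply: (@preimage_closed _ _ (fun u : R * 'rV[R]_n.+1 => \sum_i u.2 0 i)
      [set x | x = 1]); last exact: closed_eq.
    move=> u _; apply: cvg_big => [|i _]; first exact: add_continuous.
    exact: cont_coord.
  have -> : [set u : R * 'rV[R]_n.+1 | forall j, 0 <= (u.2 *m A) 0 j - u.1 * u.2 0 j] =
     \bigcap_j [set u : R * 'rV[R]_n.+1 | 0 <= (u.2 *m A) 0 j - u.1 * u.2 0 j].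
    by apply/seteqP; split => u /= h j; [move=> _; exact: h|exact: (h j I)].
  apply: closed_bigI => j _.
  apply: (@preimage_closed _ _ (fun u : R * 'rV[R]_n.+1 => (u.2 *m A) 0 j - u.1 * u.2 0 j)
    [set x | 0 <= x]); last exact: closed_ge.
  move=> u _; apply: cvgB; last by apply: cvgM; [exact: cvg_fst|exact: cont_coord].
  under eq_fun do rewrite mxE.
  rewrite mxE; apply: cvg_big => [|i _]; first exact: add_continuous.
  by apply: cvgMr_tmp; exact: cont_coord.
rewrite /cand setIC.
apply: (subclosed_compact _ cbox); last exact: subIsetr.
apply: closedI => //; apply: compact_closed cbox.
exact: norm_hausdorff.
Qed.

(** The inequality is homogeneous in [y], so [y] may be scaled to have entries of sum 1. Summing
    over [j] then bounds [s] by the sum of all entries of [A]. *)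
Let cand_normalized (s : R) (y : 'rV[R]_n.+1) : 0 <= s -> (forall j, 0 < y 0 j) ->
  (forall j, s * y 0 j <= (y *m A) 0 j) ->
  cand (s, (\sum_i y 0 i)^-1 *: y).
Proof.
move=> s0 y0 sy.
have S0 : 0 < \sum_i y 0 i.
  by rewrite big_ord_recl ltr_pwDl // sumr_ge0 // => i _; exact: ltW.
set S := \sum_i y 0 i in S0 *.
have xle j : 0 <= S^-1 * y 0 j <= 1.
  rewrite mulr_ge0 ?invr_ge0 ?(ltW S0) ?(ltW (y0 j)) //= mulrC ler_pdivrMr // mul1r.
  by rewrite /S (bigD1 j) //= lerDl sumr_ge0 // => i _; exact: ltW.
have x1 : \sum_i (S^-1 *: y) 0 i = 1.
  by under eq_bigr do rewrite mxE; rewrite -mulr_sumr mulVf // gt_eqF.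
have sx j : s * (S^-1 *: y) 0 j <= ((S^-1 *: y) *m A) 0 j.
  have ZE (w : 'rV[R]_n.+1) : (S^-1 *: w) 0 j = S^-1 * w 0 j by rewrite mxE.
  rewrite -scalemxAl !ZE mulrCA ler_wpM2l ?sy //.
  by rewrite invr_ge0 ltW.
split; last by split => //= j; rewrite subr_ge0.
split => /=; last by move=> i; rewrite in_itv /= mxE.
rewrite in_itv /= s0 /= -[leLHS]mulr1 -x1 mulr_sumr; apply: ler_sum => j _.
apply: le_trans (sx j) _; rewrite mxE; apply: ler_sum => i _.
by rewrite mxE ler_piMl ?(ltW (A_gt0 _ _)) //; have /andP[] := xle i.
Qed.

(* Collatz-Wielandt: a maximal [s] with [s x <= x A] for some [x] in the simplex is attained,
   and then equality holds, since otherwise [x A] would admit a larger value. *)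
Lemma perron_left : exists (r : R) (x : 'rV[R]_n.+1),
  [/\ 0 < r, forall i, 0 < x 0 i & x *m A = r *: x].
Proof.
have cand0 : cand !=set0.
  exists (0, (\sum_i (const_mx 1 : 'rV[R]_n.+1) 0 i)^-1 *: const_mx 1).
  apply: cand_normalized => // j; first by rewrite mxE.
  by rewrite mul0r mxE sumr_ge0 // => i _; rewrite mxE mul1r ltW.
have [|[s x] /set_mem [[/= sM xbox] [/= x1 sx]] smax] :=
  @compact_EVT_max _ R fst cand cand0 compact_cand.
  by apply: continuous_subspaceT => u; exact: cvg_fst.
have s0 : 0 <= s by move: sM; rewrite in_itv /= => /andP[].
have x0 i : 0 <= x 0 i by have := xbox i; rewrite /= in_itv /= => /andP[].
have xn0 : x != 0.
  apply/negP => /eqP xE; move: x1; rewrite xE big1 => [/eqP|i _]; last by rewrite mxE.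
  by rewrite eq_sym oner_eq0.
pose y := x *m A; have y0 : forall j, 0 < y 0 j by exact: mulmx_gt0.
(* Equality is enough: [x *m A] is entrywise positive, which forces both [s] and every entry of [x]
   to be positive. *)
suff yE : y = s *: x.
  have xj j : 0 < s * x 0 j by have := y0 j; rewrite yE mxE.
  have sp : 0 < s.
    by rewrite lt0r s0 andbT; apply/negP => /eqP sE; have := xj 0; rewrite sE mul0r ltxx.
  by exists s, x; split => // i; have := xj i; rewrite pmulr_rgt0.
(* Otherwise [y - s *: x] is nonnegative and nonzero, so multiplying it by [A] gives strict
   inequalities [s y < y A]. The least ratio [e] of slack to [y] then allows the value [s + e]. *)
apply/eqP; rewrite -subr_eq0; apply/negPn/negP => zn0.
have z0 j : 0 < ((y - s *: x) *m A) 0 j.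
  by apply: mulmx_gt0 => // i; have := sx i; rewrite !mxE.
pose q j := ((y - s *: x) *m A) 0 j / y 0 j.
pose e := q [arg min_(j < ord0) q j]%O.
have e0 : 0 < e by rewrite divr_gt0.
have eq j : e <= q j by rewrite /e; case: Order.TotalTheory.arg_minP => // i _; apply.
have /mem_set/smax /= : cand (s + e, (\sum_i y 0 i)^-1 *: y).
  apply: cand_normalized => //; first by rewrite addr_ge0 // ltW.
  move=> j; have := eq j; rewrite ler_pdivlMr // mulmxBl -scalemxAl -/y.
  by rewrite !mxE; lra.
by rewrite gerDl leNgt e0.
Qed.

End Perron.

(** * Spectral radius of a nonnegative matrix with a positive left eigenvector *)

Section SpectralRadius.
Variables (R : realType) (n : nat) (A : 'M[R]_n.+1).

(** For an eigenvalue [z] with right eigenvector [v], the triangle inequality gives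
    [|z| |v| <= A |v|] entrywise. Pairing with the positive [x] turns this into [|z| <= r]. *)
Lemma spectral_radius_perron (r : R) (x : 'rV[R]_n.+1) :
  (forall i j, 0 <= A i j) -> 0 <= r -> (forall i, 0 < x 0 i) -> x *m A = r *: x ->
  spectral_radius A = r.
Proof.
move=> A0 r0 x0 xA.
have xn0 : x != 0.
  by apply/negP => /eqP xE; have := x0 0; rewrite xE mxE ltxx.
have normE (z : R[i]) : `|z| = ((Normc.normc z)%:C)%C by case: z.
have normcR (a : R) : 0 <= a -> Normc.normc (a%:C)%C = a.
  by move=> a0; rewrite /Normc.normc /= expr0n addr0 sqrtr_sqr ger0_norm.
have Er : [set t : R | exists z : R[i],
         eigenvalue (map_mx (real_complex R) A) z /\ t = Normc.normc z] r.
  exists (r%:C)%C; rewrite normcR //; split => //.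
  apply/eigenvalueP; exists (map_mx (real_complex R) x).
    by rewrite -map_mxM xA map_mxZ.
  by rewrite map_mx_eq0.
have ubr : ubound [set t : R | exists z : R[i],
         eigenvalue (map_mx (real_complex R) A) z /\ t = Normc.normc z] r.
  move=> _ [z [ez ->]].
  (* [eigenvalue] speaks of left eigenvectors; a right one is obtained from the transpose, which has
     the same characteristic polynomial. *)
  have : eigenvalue (map_mx (real_complex R) A)^T z.
    move: ez; rewrite !eigenvalue_root_char /char_poly -det_tr /char_poly_mx.
    by rewrite linearB /= tr_scalar_mx !map_trmx.
  move=> /eigenvalueP[v vA vn0].
  pose a i := Normc.normc (v 0 i).
  have a0 i : 0 <= a i by rewrite /a; case: (v 0 i) => ? ?; exact: sqrtr_ge0.
  have za j : Normc.normc z * a j <= \sum_i A j i * a i.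
    have := congr1 (fun w : 'rV_n.+1 => `|w 0 j|) vA.
    rewrite !mxE normrM => vj.
    suff : `|z| * `|v 0 j| <= ((\sum_i A j i * a i)%:C)%C.
      by rewrite !normE -rmorphM lecR.
    rewrite -vj; apply: le_trans (ler_norm_sum _ _ _) _.
    rewrite rmorph_sum; apply: ler_sum => i _.
    by rewrite !mxE normrM !normE normcR // -rmorphM lecR mulrC.
  have S0 : 0 < \sum_j x 0 j * a j.
    rewrite lt0r sumr_ge0 ?andbT => [|j _]; last by rewrite mulr_ge0 // ltW.
    rewrite psumr_eq0 => [|j _]; last by rewrite mulr_ge0 // ltW.
    apply/negP => /allP h; move/eqP: vn0; apply; apply/rowP => j; rewrite mxE.
    have := h j (mem_index_enum _); rewrite /= mulf_eq0 (gt_eqF (x0 j)) /=.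
    by move=> /eqP /Normc.eq0_normc.
  rewrite -(ler_pM2r S0) mulr_sumr.
  apply: (@le_trans _ _ (\sum_j x 0 j * \sum_i A j i * a i)).
    by apply: ler_sum => j _; rewrite mulrCA ler_wpM2l // ltW.
  rewrite mulr_sumr; under eq_bigr do rewrite mulr_sumr.
  rewrite exchange_big; apply: ler_sum => i _.
  have := congr1 (fun w : 'rV_n.+1 => w 0 i) xA; rewrite !mxE mulrA => <-.
  by rewrite mulr_suml le_eqVlt; apply/orP; left; apply/eqP; apply: eq_bigr => j _; rewrite mulrA.
apply/eqP; rewrite eq_le; apply/andP; split.
  by apply: sup_le_ub => //; exists r.
by apply: ub_le_sup => //; exists r.
Qed.

End SpectralRadius.

(** * Decrease of the objective *)

Section Minimizer.
Variables (R : realType) (p : nat) (F : 'rV[R]_p -> R) (g : 'rV[R]_p -> 'rV[R]_p).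
Variables (mu L : R) (xs : 'rV[R]_p).
Hypothesis mu_gt0 : 0 < mu.
Hypothesis L_gt0 : 0 < L.
Hypothesis F_ge : forall x y,
  F x + frodot (g x) (y - x) + mu / 2 * fro (y - x) ^+ 2 <= F y.
Hypothesis F_le : forall x y,
  F y <= F x + frodot (g x) (y - x) + L / 2 * fro (y - x) ^+ 2.
Hypothesis F_min : forall x, F xs <= F x.

Definition gap x := 2 * (F x - F xs).

Lemma gap_ge0 x : 0 <= gap x.
Proof. by rewrite mulr_ge0 // subr_ge0. Qed.

(** The minimum is at most the value after a gradient step of length [1 / L], which [F_le]
    bounds. *)
Lemma gap_ge_grad x : fro (g x) ^+ 2 <= L * gap x.
Proof.
have h := F_le x (x - L^-1 *: g x); have := F_min (x - L^-1 *: g x).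
have xE : x - L^-1 *: g x - x = - (L^-1 *: g x) by rewrite addrC addKr.
rewrite xE froN froZ exprMn real_normK ?num_real // frodotNr frodotZr in h.
move=> h'; rewrite -fro_sqr in h.
have L0 : L != 0 by rewrite gt_eqF.
have E : L / 2 * (L^-1 ^+ 2 * fro (g x) ^+ 2) = L^-1 * fro (g x) ^+ 2 / 2 by field.
have : L^-1 * fro (g x) ^+ 2 <= gap x by rewrite /gap; lra.
by rewrite mulrC ler_pdivrMr // mulrC.
Qed.

(** Polyak-Lojasiewicz inequality: [F_ge] from [x] to the minimizer, with the square of
    [g x + mu *: (xs - x)] being nonnegative. *)
Lemma gap_le_grad x : mu * gap x <= fro (g x) ^+ 2.
Proof.
have h := F_ge x xs.
have h0 : 0 <= fro (g x + mu *: (xs - x)) ^+ 2 by exact: sqr_ge0.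
move: h0; rewrite fro_sqr !(frodotDl (g x)) !(frodotDr (g x)).
rewrite !(frodotZl, frodotZr) -!fro_sqr (frodotC (xs - x)) => h0.
have : mu * (F x + frodot (g x) (xs - x) + mu / 2 * fro (xs - x) ^+ 2) <= mu * F xs.
  by rewrite ler_pM2l.
rewrite /gap; lra.
Qed.

Lemma grad_min : g xs = 0.
Proof.
apply: fro_eq0; apply/eqP; rewrite -sqrf_eq0 eq_le sqr_ge0 andbT.
by apply: le_trans (gap_ge_grad xs) _; rewrite /gap subrr !mulr0.
Qed.

Lemma gap_ge_dist x : mu * fro (x - xs) ^+ 2 <= gap x.
Proof. by have := F_ge xs x; rewrite grad_min frodot0l addr0 /gap; lra. Qed.

(** Perturbations act on the square root of the gap in a Lipschitz way: [F_le] and [gap_ge_grad]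
    bound the new gap by a perfect square. *)
Lemma sqrt_gap_add x w :
  Num.sqrt (gap (x + w)) <= Num.sqrt (gap x) + Num.sqrt L * fro w.
Proof.
have s0 : 0 <= Num.sqrt (gap x) + Num.sqrt L * fro w.
  by rewrite addr_ge0 ?mulr_ge0 ?sqrtr_ge0 ?fro_ge0.
rewrite -ler_sqr ?nnegrE ?sqrtr_ge0 // sqr_sqrtr ?gap_ge0 //.
have h := F_le x (x + w); rewrite [x + w - x]addrAC subrr add0r in h.
have fw : frodot (g x) w <= Num.sqrt L * Num.sqrt (gap x) * fro w.
  apply: le_trans (frodot_le_fro _ _) _; rewrite ler_wpM2r ?fro_ge0 //.
  rewrite -sqrtrM ?(ltW L_gt0) // -ler_sqr ?nnegrE ?sqrtr_ge0 ?fro_ge0 //.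
  by rewrite [leRHS]sqr_sqrtr ?gap_ge_grad // mulr_ge0 ?gap_ge0 // ltW.
have -> : (Num.sqrt (gap x) + Num.sqrt L * fro w) ^+ 2 = gap x +
   2 * (Num.sqrt L * Num.sqrt (gap x) * fro w) + L * fro w ^+ 2.
  have := sqr_sqrtr (gap_ge0 x); have := sqr_sqrtr (ltW L_gt0).
  set a := Num.sqrt L; set b := Num.sqrt (gap x) => <- {1}<-; ring.
by rewrite /gap; lra.
Qed.

(** The quadratic term of [F_le] is absorbed through the second condition on [d], and the remaining
    multiple of [frodot (g x) d] is bounded below through the first. Only inner products with [d]
    enter, so [d] may be an average of Newton directions. *)
Lemma gap_descent alpha x d : 0 <= alpha -> alpha * (L / mu) <= 2 ->
  fro (g x) ^+ 2 <= L * frodot (g x) d -> mu * fro d ^+ 2 <= frodot (g x) d ->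
  gap (x - alpha *: d) <=
    gap x - 2 * alpha / L * (1 - alpha * (L / mu) / 2) * fro (g x) ^+ 2.
Proof.
move=> a0 ak gd dd; have := F_le x (x - alpha *: d).
have xE : x - alpha *: d - x = - (alpha *: d) by rewrite addrC addKr.
rewrite xE froN froZ exprMn real_normK ?num_real // frodotNr frodotZr => h.
set D := frodot _ _ in gd dd h; set G := fro (g x) ^+ 2 in gd *.
have L0 : L != 0 by rewrite gt_eqF.
have mu0 : mu != 0 by rewrite gt_eqF.
have dd' : fro d ^+ 2 <= D / mu by rewrite ler_pdivlMr // mulrC.
have gd' : G / L <= D by rewrite ler_pdivrMr // mulrC.
have h1 : L / 2 * alpha ^+ 2 * fro d ^+ 2 <= L / 2 * alpha ^+ 2 * (D / mu).
  by rewrite ler_wpM2l // mulr_ge0 ?sqr_ge0 // divr_ge0 // ltW.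
have h2 : 2 * alpha * (1 - alpha * (L / mu) / 2) * (G / L) <=
          2 * alpha * (1 - alpha * (L / mu) / 2) * D.
  by rewrite ler_wpM2l // mulr_ge0 ?mulr_ge0 // subr_ge0 ler_pdivrMr // mul1r.
have -> : 2 * alpha / L * (1 - alpha * (L / mu) / 2) * G =
          2 * alpha * (1 - alpha * (L / mu) / 2) * (G / L) by field; rewrite L0.
have E : 2 * alpha * (1 - alpha * (L / mu) / 2) * D =
         2 * alpha * D - 2 * (L / 2 * alpha ^+ 2 * (D / mu)) by field.
rewrite /gap; lra.
Qed.

End Minimizer.

(* At [G = phi] the decrease of [phi] is slowest but the feedback [B G / k] is only
   [B phi / k], which leaves the room [(1 - k^-1) B phi] for the second-order terms; at
   [G = k phi] the feedback is the full [B phi] but the decrease is [k ^ 2] times faster. *)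
Lemma contraction_tradeoff (R : realType) (k a B phi G : R) :
  1 < k -> 0 < a -> 3 * a ^+ 2 * k ^+ 4 <= B -> B < a / k ^+ 2 ->
  0 <= phi -> phi <= G -> G <= k * phi ->
  Num.sqrt (phi ^+ 2 - 2 * a / k ^+ 2 * (1 - a * k ^+ 2 / 2) * G ^+ 2) + B * G / k
    <= (1 - a / k ^+ 2 + B) * phi.
Proof.
move=> k1 a0 B3 Ba phi0 phiG Gk.
have k0 : 0 < k by lra.
have kn0 : k != 0 by rewrite gt_eqF.
have k2 : 1 < k ^+ 2 by rewrite exprn_egt1.
have k4 : 1 < k ^+ 4 by rewrite exprn_egt1.
have B0 : 0 <= B by apply: le_trans B3; rewrite !mulr_ge0 ?exprn_ge0 // ltW.
set c := a / k ^+ 2 in Ba *.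
have aE : a = c * k ^+ 2 by rewrite /c divfK // expf_neq0.
have c0 : 0 < c by rewrite divr_gt0 // exprn_gt0.
have cE : c = a * k^-1 ^+ 2 by rewrite /c exprVn.
(* The lower and upper bounds on [B] are compatible only for small [a]; this smallness controls all
   second-order terms below. *)
have c3 : 3 * c * k ^+ 8 < 1.
  have : 3 * a ^+ 2 * k ^+ 4 < c by apply: le_lt_trans Ba.
  have -> : 3 * a ^+ 2 * k ^+ 4 = c * (3 * c * k ^+ 8) by rewrite aE; ring.
  by rewrite gtr_pMr.
have cE' : 2 * a / k ^+ 2 * (1 - a * k ^+ 2 / 2) = 2 * c - a ^+ 2.
  by rewrite /c; field.
clearbody c.
have c13 : 3 * c < 1.
  apply: le_lt_trans c3; rewrite ler_peMr //; last by rewrite ltW // exprn_egt1.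
  lra.
have Gk' : G / k <= phi by rewrite ler_pdivrMr // mulrC.
have rhs0 : 0 <= (1 - c) * phi + B * (phi - G / k).
  by apply: addr_ge0; apply: mulr_ge0; rewrite ?subr_ge0 //; lra.
rewrite -lerBrDr.
have -> : (1 - c + B) * phi - B * G / k = (1 - c) * phi + B * (phi - G / k) by ring.
rewrite -[leRHS]ger0_norm // -sqrtr_sqr ler_wsqrtr //.
have h1 : ((1 - c) * phi) ^+ 2 + 2 * (1 - c) * phi * (B * (phi - G / k)) <=
          ((1 - c) * phi + B * (phi - G / k)) ^+ 2.
  rewrite [leRHS]sqrrD -addrA lerD2l.
  have := sqr_ge0 (B * (phi - G / k)); rewrite mulr2n; lra.
apply: le_trans h1.
rewrite cE'.
(* With [G = phi + D] the inequality separates: the [phi ^ 2] terms are compared by [i3], and those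
   containing [D] by [i1] and [i2]. *)
pose q := k^-1; pose D := G - phi.
have q0 : 0 < q by rewrite invr_gt0.
have q1 : q < 1 by rewrite invf_lt1.
have D0 : 0 <= D by rewrite subr_ge0.
have GE : G = phi + D by rewrite /D; ring.
have a2 : a ^+ 2 <= c / 3.
  have -> : a ^+ 2 = c * (c * k ^+ 4) by rewrite aE; ring.
  rewrite ler_wpM2l ?(ltW c0) //.
  have : c * k ^+ 4 <= c * k ^+ 8.
    by rewrite ler_wpM2l ?(ltW c0) // ler_weXn2l ?(ltW k1).
  lra.
have i1 : 5 / 3 * c * (2 * phi * D) <= (2 * c - a ^+ 2) * (2 * phi * D + D ^+ 2).
  have := mulr_ge0 phi0 D0 => pD.
  apply: (@le_trans _ _ ((2 * c - a ^+ 2) * (2 * phi * D))).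
    by rewrite ler_wpM2r //; lra.
  by rewrite ler_wpM2l ?lerDl ?sqr_ge0 //; lra.
have i2 : 2 * (1 - c) * phi * B * (D * q) <= 2 * c * (phi * D).
  have h : (1 - c) * (B * q) <= c.
    have h1 : B * q <= B by rewrite ler_piMr ?(ltW q1).
    have h2 : (1 - c) * (B * q) <= B * q.
      by rewrite ler_piMl ?mulr_ge0 ?(ltW q0) //; lra.
    lra.
  have := ler_wpM2r (mulr_ge0 phi0 D0) h; lra.
(* Both sides carry a factor [1 - q], since [c = a * q ^+ 2]. The constant 3 in the lower bound on
   [B] is what [4 * a ^+ 2] on the left requires, given [1 - c >= 2 / 3]. *)
have i3 : a ^+ 2 - c ^+ 2 <= 2 * (1 - c) * B * (1 - q).
  have h1 : 1 - q ^+ 4 <= 4 * (1 - q).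
    have -> : 1 - q ^+ 4 = ((1 + q) * (1 + q ^+ 2)) * (1 - q) by ring.
    rewrite ler_wpM2r ?subr_ge0 ?(ltW q1) //.
    have : q ^+ 2 <= 1 by rewrite exprn_ile1 ?(ltW q0) ?(ltW q1).
    have := sqr_ge0 q; nra.
  have h2 : a ^+ 2 * (1 - q ^+ 4) <= a ^+ 2 * (4 * (1 - q)) by rewrite ler_wpM2l ?sqr_ge0.
  have h3 : 3 * a ^+ 2 <= B.
    by apply: le_trans B3; rewrite ler_peMr ?(ltW k4) // mulr_ge0 ?sqr_ge0.
  have h4 : 3 * a ^+ 2 * (1 - q) <= B * (1 - q) by rewrite ler_wpM2r ?subr_ge0 ?(ltW q1).
  have h5 : 2 / 3 * (B * (1 - q)) <= (1 - c) * (B * (1 - q)).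
    by rewrite ler_wpM2r ?mulr_ge0 ?subr_ge0 ?(ltW q1) //; lra.
  have -> : a ^+ 2 - c ^+ 2 = a ^+ 2 * (1 - q ^+ 4) by rewrite cE -/q; ring.
  lra.
have i4 := ler_wpM2r (sqr_ge0 phi) i3.
have -> : phi - G / k = phi * (1 - q) - D * q by rewrite GE -/q; ring.
have pD : 0 <= c * (phi * D) by rewrite mulr_ge0 ?(ltW c0) ?mulr_ge0.
rewrite GE; lra.
Qed.

(** * Averaging over the agents *)

Section Averaging.
Variables (R : realType) (N p : nat).
Hypothesis N_gt0 : (0 < N)%N.
Implicit Types (M A B : 'M[R]_(N, p)) (m : 'rV[R]_p).

Definition replicate m : 'M[R]_(N, p) := (const_mx 1 : 'cV[R]_N) *m m.

Let N0 : (N%:R : R) != 0.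
Proof. by rewrite pnatr_eq0 -lt0n. Qed.

Lemma row_replicate i m : row i (replicate m) = m.
Proof. by apply/rowP => j; rewrite !mxE big_ord1 mxE mul1r. Qed.

Lemma replicateD m m' : replicate (m + m') = replicate m + replicate m'.
Proof. exact: mulmxDr. Qed.

Lemma replicateN m : replicate (- m) = - replicate m.
Proof. exact: mulmxN. Qed.

Lemma replicateZ a m : replicate (a *: m) = a *: replicate m.
Proof. by rewrite /replicate -scalemxAr. Qed.

Lemma avgE M : avg M = N%:R^-1 *: \sum_i row i M.
Proof.
rewrite /avg -scalemxAl; congr (_ *: _); apply/rowP => j.
rewrite summxE mxE; apply: eq_bigr => i _; by rewrite !mxE mul1r.
Qed.

Lemma avgD A B : avg (A + B) = avg A + avg B.
Proof. exact: mulmxDr. Qed.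

Lemma avgN A : avg (- A) = - avg A.
Proof. exact: mulmxN. Qed.

Lemma avgZ a A : avg (a *: A) = a *: avg A.
Proof. by rewrite /avg scalemxAr. Qed.

Lemma avg_replicate m : avg (replicate m) = m.
Proof.
rewrite avgE; under eq_bigr do rewrite row_replicate.
by rewrite sumr_const card_ord -(scaler_nat _ m) scalerA mulVf // scale1r.
Qed.

Lemma consensusE M : consensus M = replicate (avg M).
Proof. by []. Qed.

Lemma consensusD A B : consensus (A + B) = consensus A + consensus B.
Proof. by rewrite !consensusE avgD replicateD. Qed.

Lemma consensusB A B : consensus (A - B) = consensus A - consensus B.
Proof. by rewrite !consensusE avgD avgN replicateD replicateN. Qed.

Lemma fro_replicate m : fro (replicate m) = Num.sqrt N%:R * fro m.
Proof.
apply/eqP; rewrite -(@eqrXn2 _ 2) ?mulr_ge0 ?sqrtr_ge0 ?fro_ge0 // exprMn.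
rewrite !fro_sqr sqr_sqrtr ?ler0n // frodot_rows.
under eq_bigr do rewrite row_replicate.
by rewrite sumr_const card_ord mulr_natl.
Qed.

(** Pythagoras: [consensus] is the orthogonal projection onto matrices with equal rows. *)
Lemma frodot_consensus M :
  frodot (M - consensus M) (M - consensus M) =
  frodot M M - N%:R * frodot (avg M) (avg M).
Proof.
have E A : frodot A (consensus M) = N%:R * frodot (avg A) (avg M).
  rewrite consensusE frodot_rows (avgE A) frodotZl mulrA divff // mul1r frodot_suml.
  by apply: eq_bigr => i _; rewrite row_replicate.
rewrite frodotDr !frodotDl !frodotNr !frodotNl (frodotC (consensus M) M) !E.
by rewrite consensusE avg_replicate; ring.
Qed.

Lemma fro_dev M : fro (M - consensus M) <= fro M.
Proof.
rewrite fro_le_bound ?fro_ge0 // fro_sqr frodot_consensus gerBl mulr_ge0 ?ler0n //.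
by rewrite -fro_sqr sqr_ge0.
Qed.

Lemma fro_avg_sqr M : N%:R * fro (avg M) ^+ 2 <= fro M ^+ 2.
Proof.
rewrite !fro_sqr -subr_ge0 -frodot_consensus -fro_sqr; exact: sqr_ge0.
Qed.

Lemma fro_avg M : Num.sqrt N%:R * fro (avg M) <= fro M.
Proof.
rewrite -ler_sqr ?nnegrE ?mulr_ge0 ?sqrtr_ge0 ?fro_ge0 // exprMn.
by rewrite [X in X * _]sqr_sqrtr ?ler0n // fro_avg_sqr.
Qed.

Variable W : 'M[R]_N.
Hypothesis W_mix : mixing_matrix W.

Let J : 'M[R]_N := N%:R^-1 *: const_mx 1.

Lemma consensus_mulmx M : consensus M = J *m M.
Proof.
rewrite /consensus /avg mulmxA; congr (_ *m _).
by apply/matrixP => i j; rewrite !mxE big_ord1 !mxE mul1r.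
Qed.

Lemma avg_mix M : avg (W *m M) = avg M.
Proof.
rewrite /avg mulmxA; congr (_ *m _); apply/rowP => j; rewrite !mxE.
case: W_mix => _ [_ [cW _]].
by under eq_bigr do rewrite !mxE; rewrite -mulr_sumr cW !mulr1.
Qed.

Lemma mix_replicate m : W *m replicate m = replicate m.
Proof.
rewrite /replicate mulmxA; congr (_ *m _); apply/colP => i; rewrite !mxE.
case: W_mix => _ [rW _].
by under eq_bigr do rewrite mxE mulr1.
Qed.

(** [W] and [J] agree on matrices with equal rows, so [W - J] sees only the deviation from
    consensus. *)
Lemma dev_mix M :
  fro (W *m M - consensus (W *m M)) <= spec_norm (W - J) * fro (M - consensus M).
Proof.
suff -> : W *m M - consensus (W *m M) = (W - J) *m (M - consensus M).
  exact: spec_norm_mulmx.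
rewrite mulmxBl -consensus_mulmx consensusB mulmxBr !consensusE avg_mix.
by rewrite mix_replicate avg_replicate subrr subr0.
Qed.

Lemma fro_mix_sub M :
  fro (W *m M - M) <= spec_norm (W - 1%:M) * fro (M - consensus M).
Proof.
suff -> : W *m M - M = (W - 1%:M) *m (M - consensus M).
  exact: spec_norm_mulmx.
by rewrite mulmxBl mul1mx mulmxBr consensusE mix_replicate opprB addrA subrK.
Qed.

End Averaging.

(** The difference [v] of two basis vectors is annihilated by the averaging matrix, so [v] is the
    difference of its images under [W - J] and [W - 1%:M]. [coupling_ge] uses this bound. *)
Lemma spec_norm_mix_ge (R : realType) (N : nat) (W : 'M[R]_N) : (2 <= N)%N ->
  1 - spec_norm (W - N%:R^-1 *: (const_mx 1 : 'M[R]_N)) <= spec_norm (W - 1%:M).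
Proof.
move=> N2.
pose i0 : 'I_N := Ordinal (ltnW N2); pose i1 : 'I_N := Ordinal N2.
pose v : 'cV[R]_N := delta_mx i0 0 - delta_mx i1 0.
have v0 : 0 < fro v.
  rewrite lt0r fro_ge0 andbT; apply/negP => /eqP /fro_eq0 /colP /(_ i0).
  by rewrite !mxE !eqxx /= subr0 => /eqP; rewrite oner_eq0.
have Jv : (const_mx 1 : 'M[R]_N) *m v = 0.
  apply/colP => i; rewrite mulmxBr !mxE.
  rewrite (bigD1 i0) //= big1 => [|j /negPf ji0]; last by rewrite !mxE ji0 mulr0.
  rewrite (bigD1 i1) //= big1 => [|j /negPf ji1]; last by rewrite !mxE ji1 mulr0.
  by rewrite !mxE !eqxx; lra.
set J := N%:R^-1 *: _.
have vE : v = (W - J) *m v - (W - 1%:M) *m v.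
  by rewrite !mulmxBl mul1mx -scalemxAl Jv scaler0 subr0 opprB addrC subrK.
rewrite lerBlDl -(ler_pM2r v0) mul1r mulrDl {1}vE.
apply: le_trans (fro_triangle _ _) _; rewrite froN.
by apply: lerD; exact: spec_norm_mulmx.
Qed.

(** * One step of the algorithm *)

Section Algorithm.
Variables (R : realType) (N p : nat).
Variables (f : 'I_N -> 'rV[R]_p -> R) (grad : 'I_N -> 'rV[R]_p -> 'rV[R]_p).
Variables (hess : 'I_N -> 'rV[R]_p -> 'M[R]_p).
Variables (mu L : R) (xstar : 'rV[R]_p) (W : 'M[R]_N) (alpha beta : R).
Hypothesis N_gt0 : (0 < N)%N.
Hypothesis fdiff : forall i x, differentiable (f i) x.
Hypothesis fgrad : forall i x v, 'd (f i) x v = (v *m (grad i x)^T) 0 0.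
Hypothesis gdiff : forall i x, differentiable (grad i) x.
Hypothesis ghess : forall i x v, 'd (grad i) x v = v *m (hess i x)^T.
Hypothesis quad_ge : forall i x v, mu * fro v ^+ 2 <= quad (hess i x) v.
Hypothesis gLip : forall i x y, fro (grad i x - grad i y) <= L * fro (x - y).
Hypothesis mu_gt0 : 0 < mu.
Hypothesis L_gt0 : 0 < L.
Hypothesis xstar_min : forall x,
  N%:R^-1 * \sum_(i < N) f i xstar <= N%:R^-1 * \sum_(i < N) f i x.
Hypothesis W_mix : mixing_matrix W.
Hypothesis alpha_ge0 : 0 <= alpha.
Hypothesis beta_ge0 : 0 <= beta.

Let kappa := L / mu.
Hypothesis alpha_kappa : alpha * kappa <= 2.

Let Nr_gt0 : (0 : R) < N%:R.
Proof. by rewrite ltr0n. Qed.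

Let F x := N%:R^-1 * \sum_(i < N) f i x.
Let gF x := N%:R^-1 *: \sum_(i < N) grad i x.

Let avg_cst (c : R) : c = N%:R^-1 * \sum_(i < N) c.
Proof. by rewrite sumr_const card_ord -(mulr_natl c) mulKf // gt_eqF. Qed.

Let F_ge x y : F x + frodot (gF x) (y - x) + mu / 2 * fro (y - x) ^+ 2 <= F y.
Proof.
rewrite /F /gF frodotZl frodot_suml [_ * fro _ ^+ 2]avg_cst -!mulrDr -!big_split /=.
rewrite ler_wpM2l ?invr_ge0 ?ler0n //; apply: ler_sum => i _.
exact: (strong_convexity (fdiff i) (fgrad i) (gdiff i) (ghess i) (quad_ge i)).
Qed.

Let F_le x y : F y <= F x + frodot (gF x) (y - x) + L / 2 * fro (y - x) ^+ 2.
Proof.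
rewrite /F /gF frodotZl frodot_suml [_ * fro _ ^+ 2]avg_cst -!mulrDr -!big_split /=.
rewrite ler_wpM2l ?invr_ge0 ?ler0n //; apply: ler_sum => i _.
exact: (descent (fdiff i) (fgrad i) (gLip i)).
Qed.

Definition opt_err (x : 'rV[R]_p) : R :=
  Num.sqrt (N%:R / mu) * Num.sqrt (gap F xstar x).

Definition grad_err (x : 'rV[R]_p) : R := Num.sqrt N%:R * fro (gF x) / mu.

Lemma opt_err_ge0 x : 0 <= opt_err x.
Proof. by rewrite mulr_ge0 ?sqrtr_ge0. Qed.

Lemma grad_err_ge0 x : 0 <= grad_err x.
Proof. by rewrite !mulr_ge0 ?sqrtr_ge0 ?fro_ge0 // invr_ge0 ltW. Qed.

Let Nmu_ge0 : 0 <= N%:R / mu.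
Proof. by rewrite divr_ge0 ?ltW. Qed.

Let opt_err_sqr x : opt_err x ^+ 2 = N%:R / mu * gap F xstar x.
Proof. by rewrite exprMn !sqr_sqrtr // (gap_ge0 xstar_min). Qed.

Let grad_err_sqr x : grad_err x ^+ 2 = N%:R / mu ^+ 2 * fro (gF x) ^+ 2.
Proof. by rewrite !exprMn [X in X * _ * _]sqr_sqrtr ?ltW // exprVn mulrAC. Qed.

Lemma dist_le_opt_err x : Num.sqrt N%:R * fro (x - xstar) <= opt_err x.
Proof.
rewrite -ler_sqr ?nnegrE ?opt_err_ge0 ?mulr_ge0 ?sqrtr_ge0 ?fro_ge0 //.
rewrite opt_err_sqr exprMn [X in X * _]sqr_sqrtr ?(ltW Nr_gt0) // -mulrA.
rewrite ler_wpM2l ?(ltW Nr_gt0) // mulrC ler_pdivlMr // mulrC.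
exact: (gap_ge_dist L_gt0 F_ge F_le xstar_min).
Qed.

Lemma opt_err_le_grad x : opt_err x <= grad_err x.
Proof.
rewrite -ler_sqr ?nnegrE ?opt_err_ge0 ?grad_err_ge0 //.
rewrite opt_err_sqr grad_err_sqr.
have -> : N%:R / mu ^+ 2 * fro (gF x) ^+ 2 = N%:R / mu * (fro (gF x) ^+ 2 / mu).
  by field; rewrite gt_eqF.
rewrite ler_wpM2l // ler_pdivlMr // mulrC.
exact: (gap_le_grad _ mu_gt0 F_ge).
Qed.

Lemma grad_err_le_opt x : grad_err x <= Num.sqrt kappa * opt_err x.
Proof.
have k0 : 0 <= kappa by rewrite divr_ge0 // ltW.
rewrite -ler_sqr ?nnegrE ?grad_err_ge0 ?(mulr_ge0 (sqrtr_ge0 _) (opt_err_ge0 _)) //.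
rewrite grad_err_sqr exprMn opt_err_sqr [X in _ <= X * _]sqr_sqrtr //.
have -> : kappa * (N%:R / mu * gap F xstar x) = N%:R / mu ^+ 2 * (L * gap F xstar x).
  by rewrite /kappa; field; rewrite gt_eqF.
rewrite ler_wpM2l //; last exact: (gap_ge_grad L_gt0 F_le xstar_min).
by rewrite divr_ge0 ?exprn_ge0 // ltW.
Qed.

Lemma row_Dmat X Y i : row i (Dmat hess X Y) = newton (hess i) (row i X) (row i Y).
Proof. by apply/rowP => j; rewrite !mxE. Qed.

Lemma DmatD X Y Z : Dmat hess X (Y + Z) = Dmat hess X Y + Dmat hess X Z.
Proof.
apply/row_matrixP => i; rewrite linearD /= !row_Dmat linearD /=; exact: newtonD.
Qed.

Lemma fro_Dmat X Y : fro (Dmat hess X Y) <= mu^-1 * fro Y.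
Proof.
apply: fro_le_rows => [|i]; first by rewrite invr_ge0 ltW.
by rewrite row_Dmat; exact: (fro_newton (quad_ge i)).
Qed.

Lemma fro_Gmat X X' : fro (Gmat grad X - Gmat grad X') <= L * fro (X - X').
Proof.
apply: fro_le_rows => [|i]; first exact: ltW.
have rG Z : row i (Gmat grad Z) = grad i (row i Z).
  by apply/rowP => j; rewrite !mxE.
by rewrite !linearB /= !rG; exact: gLip.
Qed.

Lemma avg_Gmat_replicate x : avg (Gmat grad (replicate N x)) = gF x.
Proof.
rewrite avgE; congr (_ *: _); apply: eq_bigr => i _.
by apply/rowP => j; rewrite !mxE row_replicate.
Qed.

Section Step.
Variables (X Xp Y : 'M[R]_(N, p)).
Hypothesis avgY : avg Y = avg (Gmat grad X).
Let X' := W *m X - alpha *: Dmat hess X Y + beta *: (X - Xp).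
Let Y' := W *m Y + (Gmat grad X' - Gmat grad X).
Let E1 := fro (X - consensus X).
Let E2 := fro (Y - consensus Y).
Let E4 := fro (X - Xp).
Let G := grad_err (avg X).
Let T := alpha * (kappa * E1 + E2 / mu + G).
Let gb : 'M[R]_(N, p) := replicate N (gF (avg X)).
Let sigma := spec_norm (W - N%:R^-1 *: (const_mx 1 : 'M[R]_N)).
Let vs := spec_norm (W - 1%:M).

(** The mean of [Y] is the mean of the local gradients at the rows of [X]; replacing these rows by
    their average costs [L * E1] by the Lipschitz bound. *)
Let track_err : fro (Y - gb) <= E2 + L * E1.
Proof.
have -> : Y - gb = (Y - consensus Y) + (consensus Y - gb) by rewrite addrA subrK.
apply: le_trans (fro_triangle _ _) _; rewrite lerD2l.
rewrite consensusE /gb -replicateN -replicateD fro_replicate.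
rewrite avgY -avg_Gmat_replicate -avgN -avgD.
by apply: le_trans (fro_avg N_gt0 _) _; exact: fro_Gmat.
Qed.

Let fro_D : alpha * fro (Dmat hess X Y) <= T.
Proof.
rewrite ler_wpM2l //; apply: le_trans (fro_Dmat _ _) _.
have Yb : fro Y <= E2 + L * E1 + Num.sqrt N%:R * fro (gF (avg X)).
  rewrite -fro_replicate -/gb -{1}[Y](subrK gb).
  by apply: le_trans (fro_triangle _ _) _; rewrite lerD2r.
have -> : kappa * E1 + E2 / mu + G =
    mu^-1 * (E2 + L * E1 + Num.sqrt N%:R * fro (gF (avg X))).
  by rewrite /G /grad_err /kappa; ring.
by rewrite ler_wpM2l // invr_ge0 ltW.
Qed.

Lemma step_x_dev : fro (X' - consensus X') <= sigma * E1 + T + beta * E4.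
Proof.
pose dev (M : 'M[R]_(N, p)) := M - consensus M.
have devD A B : dev (A + B) = dev A + dev B.
  by rewrite /dev consensusD opprD addrACA.
have devZ a A : dev (a *: A) = a *: dev A.
  by rewrite /dev scalerBr !consensusE avgZ replicateZ.
rewrite -/(dev X') !devD -scaleNr !devZ.
apply: le_trans (fro_triangle _ _) _; apply: lerD.
  apply: le_trans (fro_triangle _ _) _; apply: lerD; first exact: dev_mix.
  apply: le_trans fro_D; rewrite froZ normrN ger0_norm // ler_wpM2l //.
  exact: fro_dev.
by rewrite froZ ger0_norm // ler_wpM2l //; exact: fro_dev.
Qed.

Lemma step_x_diff : fro (X' - X) <= vs * E1 + T + beta * E4.
Proof.
have -> : X' - X = (W *m X - X) - alpha *: Dmat hess X Y + beta *: (X - Xp).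
  by rewrite /X' [LHS]addrAC; congr (_ + _); exact: addrAC.
apply: le_trans (fro_triangle _ _) _; apply: lerD.
  apply: le_trans (fro_triangle _ _) _; apply: lerD; first exact: fro_mix_sub.
  by rewrite froN froZ ger0_norm.
by rewrite froZ ger0_norm.
Qed.

Lemma step_y_dev :
  fro (Y' - consensus Y') <= sigma * E2 + L * fro (X' - X).
Proof.
rewrite /Y' consensusD opprD addrACA.
apply: le_trans (fro_triangle _ _) _; apply: lerD; first exact: dev_mix.
by apply: le_trans (fro_dev N_gt0 _) _; exact: fro_Gmat.
Qed.

(** Gradient tracking invariant: mixing preserves averages, and the gradient increments
    telescope. *)
Lemma step_avg_y : avg Y' = avg (Gmat grad X').
Proof. by rewrite /Y' avgD avg_mix // avgD avgN avgY addrC subrK. Qed.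

(** The direction splits along [Y = gb + (Y - gb)]. The part [d] from the common gradient decreases
    the gap by [gap_descent]; the tracking error and the momentum form [w], which enters through
    [sqrt_gap_add] and brings the factor [Num.sqrt kappa]. *)
Lemma step_opt_err : opt_err (avg X') <=
  Num.sqrt (opt_err (avg X) ^+ 2 -
     2 * alpha / kappa * (1 - alpha * kappa / 2) * G ^+ 2) +
  Num.sqrt kappa * (alpha * (kappa * E1 + E2 / mu) + beta * E4).
Proof.
set x := avg X; pose d := avg (Dmat hess X gb).
pose w := beta *: avg (X - Xp) - alpha *: avg (Dmat hess X (Y - gb)).
have xE : avg X' = x - alpha *: d + w.
  rewrite /X' !avgD avgN !avgZ avg_mix // -/x -{1}[Y](subrK gb) DmatD avgD scalerDr.
  rewrite /w -/d (addrC (alpha *: avg _)) opprD !addrA -!addrA.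
  by congr (_ + (_ + _)); rewrite addrC.
have gd : fro (gF x) ^+ 2 <= L * frodot (gF x) d.
  rewrite /d avgE frodotC frodotZl frodot_suml [leLHS]avg_cst mulrCA.
  rewrite ler_wpM2l ?invr_ge0 ?ler0n // mulr_sumr; apply: ler_sum => i _.
  rewrite row_Dmat row_replicate frodotC.
  exact: (newton_dot_ge_grad (fdiff i) (fgrad i) (gdiff i) (ghess i) (quad_ge i) (gLip i)).
(* Convexity of the square passes the agentwise bounds [newton_dot_ge] to their average. *)
have dd : mu * fro d ^+ 2 <= frodot (gF x) d.
  rewrite -(ler_pM2l Nr_gt0) mulrCA.
  apply: (@le_trans _ _ (mu * fro (Dmat hess X gb) ^+ 2)).
    by rewrite ler_pM2l // fro_avg_sqr.
  rewrite /d avgE [frodot (gF x) _]frodotC frodotZl mulVKf ?gt_eqF // frodot_suml.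
  rewrite fro_sqr frodot_rows mulr_sumr; apply: ler_sum => i _.
  rewrite row_Dmat row_replicate -fro_sqr frodotC.
  exact: (newton_dot_ge (quad_ge i)).
have wb : Num.sqrt N%:R * fro w <= alpha * (kappa * E1 + E2 / mu) + beta * E4.
  apply: (@le_trans _ _ (Num.sqrt N%:R * (beta * fro (avg (X - Xp)) +
     alpha * fro (avg (Dmat hess X (Y - gb)))))).
    rewrite ler_wpM2l ?sqrtr_ge0 //; apply: le_trans (fro_triangle _ _) _.
    by rewrite froN !froZ !ger0_norm.
  rewrite mulrDr addrC !(mulrCA (Num.sqrt _)); apply: lerD; rewrite ler_wpM2l //.
    apply: le_trans (fro_avg N_gt0 _) _; apply: le_trans (fro_Dmat _ _) _.
    have -> : kappa * E1 + E2 / mu = mu^-1 * (E2 + L * E1) by rewrite /kappa; ring.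
    by rewrite ler_wpM2l // invr_ge0 ltW.
  exact: fro_avg.
have descd := gap_descent xstar mu_gt0 L_gt0 F_le alpha_ge0 alpha_kappa gd dd.
rewrite xE.
apply: (@le_trans _ _ (Num.sqrt (N%:R / mu) *
   (Num.sqrt (gap F xstar (x - alpha *: d)) + Num.sqrt L * fro w))).
  rewrite ler_wpM2l ?sqrtr_ge0 //.
  exact: (sqrt_gap_add L_gt0 F_le xstar_min).
rewrite mulrDr; apply: lerD.
  rewrite -sqrtrM // ler_wsqrtr // opt_err_sqr grad_err_sqr.
  apply: le_trans (ler_wpM2l Nmu_ge0 descd) _.
  rewrite le_eqVlt; apply/orP; left; apply/eqP; rewrite /kappa.
  by field; rewrite !gt_eqF.
apply: le_trans (ler_wpM2l (sqrtr_ge0 kappa) wb).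
have k0 : 0 <= kappa by rewrite divr_ge0 // ltW.
rewrite le_eqVlt; apply/orP; left; apply/eqP; rewrite !mulrA; congr (_ * _).
by rewrite -!sqrtrM //; congr Num.sqrt; rewrite /kappa; ring.
Qed.

End Step.
End Algorithm.

(** * The Lyapunov function *)

(* [(l1, l2, l3, l4) *m Amat = rho *: (l1, l2, l3, l4)], column by column, with the common
   factor [m] collected and [L / mu = kappa] used. *)
Definition left_eigen4 (R : realType) (mu L kappa vs sigma alpha beta rho l1 l2 l3 l4 : R) :=
  let m := l1 + L * l2 + l3 + l4 in
  [/\ (rho - sigma) * l1 = alpha * kappa * m + vs * (L * l2 + l4),
      (rho - sigma) * l2 = alpha / mu * m,
      (rho - 1 + alpha / kappa) * l3 = alpha * kappa * (l1 + L * l2 + l4) &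
      rho * l4 = beta * m].

(** The condition [alpha / kappa < 1] makes the third diagonal entry positive, hence the whole
    matrix, and Perron's theorem applies. *)
Lemma perron_Amat (R : realType) (mu L vs sigma alpha beta : R) :
  let kappa := L / mu in
  0 < mu -> 0 < L -> 0 <= vs -> 0 <= sigma -> 0 < alpha -> alpha / kappa < 1 -> 0 < beta ->
  exists rho l1 l2 l3 l4 : R,
    [/\ 0 < rho, [/\ 0 < l1, 0 < l2, 0 < l3 & 0 < l4],
        left_eigen4 mu L kappa vs sigma alpha beta rho l1 l2 l3 l4 &
        spectral_radius (Amat mu L kappa vs sigma alpha beta) = rho].
Proof.
move=> kappa mu0 L0 vs0 sg0 al0 alk be0.
have k0 : 0 < kappa by rewrite divr_gt0.
have ak0 : 0 < alpha * kappa by rewrite mulr_gt0.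
have A0 i j : 0 < Amat mu L kappa vs sigma alpha beta i j.
  have a1 : 0 < alpha / mu by rewrite divr_gt0.
  have a2 : 0 < L * (vs + alpha * kappa) by rewrite mulr_gt0 // ltr_wpDl.
  have a3 : 0 < L * alpha * kappa by rewrite -mulrA mulr_gt0.
  have a4 : 0 < L * beta by rewrite mulr_gt0.
  rewrite mxE; case: i => [[|[|[|[|//]]]] ?]; case: j => [[|[|[|[|//]]]] ?] //=; lra.
have [rho [l [rho0 lpos lA]]] := perron_left A0.
have sr := spectral_radius_perron (fun i j => ltW (A0 i j)) (ltW rho0) lpos lA.
(* The indices 1, 2, 3 in the form produced by [big_ord_recl]. *)
pose i1 : 'I_4 := lift ord0 ord0; pose i2 : 'I_4 := lift ord0 (lift ord0 ord0).
pose i3 : 'I_4 := lift ord0 (lift ord0 (lift ord0 ord0)).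
exists rho, (l 0 0), (l 0 i1), (l 0 i2), (l 0 i3).
have E j := congr1 (fun w : 'rV_4 => w 0 j) lA.
split => //.
have Lmu : L = kappa * mu by rewrite /kappa divfK // gt_eqF.
have muV : mu != 0 by rewrite gt_eqF.
have e0 := E 0; have e1 := E i1; have e2 := E i2; have e3 := E i3.
rewrite !mxE !big_ord_recl !big_ord0 !mxE /= -?/i1 -?/i2 -?/i3 in e0 e1 e2 e3.
move: e0 e1 e2 e3.
set m0 := l 0 0; set m1 := l 0 i1; set m2 := l 0 i2; set m3 := l 0 i3.
move=> e0 e1 e2 e3.
have aLm : alpha / mu * L = alpha * kappa by rewrite Lmu; field.
split.
- lra.
- have : alpha / mu * L * m1 = alpha * kappa * m1 by rewrite aLm.
  lra.
- lra.
- lra.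
Qed.

(** Supplies the lower bound on [B] in [contraction_tradeoff]. As [rho - sigma] is at most 1 and at
    most [vs], the second column gives [L * l2 >= alpha * k ^+ 2 * m] and the first
    [l1 >= alpha * k ^+ 2 * m + L * l2]; the third column then yields the factor 3. *)
Lemma coupling_ge (R : realType) (mu L k vs sigma alpha beta rho l1 l2 l3 l4 : R) :
  0 < mu -> 0 < L -> 1 < k -> L / mu = k ^+ 2 -> 0 <= sigma -> 1 - sigma <= vs ->
  0 < alpha -> rho < 1 -> 0 < l1 -> 0 < l2 -> 0 < l3 -> 0 < l4 ->
  left_eigen4 mu L (k ^+ 2) vs sigma alpha beta rho l1 l2 l3 l4 ->
  3 * alpha ^+ 2 * k ^+ 4 <= rho - 1 + alpha / k ^+ 2.
Proof.
move=> mu_gt0 L_gt0 k_gt1 kappaE sigma_ge0 vs_ge alpha_gt0 rho_lt1.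
move=> l1_gt0 l2_gt0 l3_gt0 l4_gt0 [].
have k_gt0 : 0 < k by exact: lt_trans k_gt1.
have rs1 : rho - sigma <= 1 by rewrite lerBlDr (le_trans (ltW rho_lt1)) // lerDl.
have rsv : rho - sigma <= vs by apply: le_trans vs_ge; rewrite lerD2r ltW.
set m := l1 + L * l2 + l3 + l4 => E1 E2 E3 _.
have m0 : 0 < m by rewrite !addr_gt0 // mulr_gt0.
have l3m : l3 <= m.
  by rewrite /m addrAC lerDr !addr_ge0 // ltW // mulr_gt0.
clearbody m.
have ak0 : 0 < alpha * k ^+ 2 by rewrite mulr_gt0 // exprn_gt0.
have akm : 0 < alpha * k ^+ 2 * m by rewrite mulr_gt0.
have rs0 : 0 < rho - sigma.
  by rewrite -(pmulr_lgt0 _ l2_gt0) E2 mulr_gt0 // divr_gt0.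
have Ll2 : 0 < L * l2 by rewrite mulr_gt0.
have E2' : (rho - sigma) * (L * l2) = alpha * k ^+ 2 * m.
  by rewrite mulrCA E2 -kappaE; ring.
have h2 : alpha * k ^+ 2 * m <= L * l2.
  by rewrite -E2' ler_piMl // ltW.
have h1 : alpha * k ^+ 2 * m + L * l2 <= l1.
  rewrite -(ler_pM2l rs0) E1 mulrDr mulrDr; apply: lerD.
    by rewrite ler_piMl // ltW.
  rewrite -[leLHS]addr0; apply: lerD; first by rewrite ler_wpM2r // ltW.
  by rewrite mulr_ge0 ?(ltW l4_gt0) // (le_trans (ltW rs0)).
rewrite -(ler_pM2r l3_gt0) E3.
have -> : 3 * alpha ^+ 2 * k ^+ 4 * l3 =
   alpha * k ^+ 2 * (3 * (alpha * k ^+ 2 * l3)) by ring.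
rewrite ler_wpM2l ?(ltW ak0) //.
have lm : alpha * k ^+ 2 * l3 <= alpha * k ^+ 2 * m.
  by rewrite ler_wpM2l ?(ltW ak0).
lra.
Qed.

(** In the weighted sum of the four bounds, the eigenvector equations give [e1], [e2], [e4] the
    coefficients [rho * l1], [rho * l2], [rho * l4]. The weight [l3 / k] cancels the factor [k] in
    the bound on [phi'], and [contraction_tradeoff] handles the terms in [phi] and [G]. *)
Lemma lyapunov_step (R : realType) (mu L k vs sigma alpha beta rho l1 l2 l3 l4 : R)
    (e1 e2 e4 phi G e1' e2' e4' phi' : R) :
  0 < mu -> 0 < L -> 1 < k -> L / mu = k ^+ 2 -> 0 <= sigma -> 1 - sigma <= vs ->
  0 < alpha -> rho < 1 -> 0 < l1 -> 0 < l2 -> 0 < l3 -> 0 < l4 ->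
  left_eigen4 mu L (k ^+ 2) vs sigma alpha beta rho l1 l2 l3 l4 ->
  let T := alpha * (k ^+ 2 * e1 + e2 / mu + G) in
  0 <= phi -> phi <= G -> G <= k * phi ->
  e1' <= sigma * e1 + T + beta * e4 -> e4' <= vs * e1 + T + beta * e4 ->
  e2' <= sigma * e2 + L * e4' ->
  phi' <= Num.sqrt (phi ^+ 2 -
      2 * alpha / k ^+ 2 * (1 - alpha * k ^+ 2 / 2) * G ^+ 2) +
    k * (alpha * (k ^+ 2 * e1 + e2 / mu) + beta * e4) ->
  l1 * e1' + l2 * e2' + l3 / k * phi' + l4 * e4' <=
  rho * (l1 * e1 + l2 * e2 + l3 / k * phi + l4 * e4).
Proof.
move=> mu_gt0 L_gt0 k_gt1 kappaE sigma_ge0 vs_ge alpha_gt0 rho_lt1.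
move=> l1_gt0 l2_gt0 l3_gt0 l4_gt0 l_eigen T phi0 phiG Gk h1 h4 h2 h3.
have k_gt0 : 0 < k by exact: lt_trans k_gt1.
have [B BE] : exists B, B = rho - 1 + alpha / k ^+ 2 by eexists.
have Bge := coupling_ge mu_gt0 L_gt0 k_gt1 kappaE sigma_ge0 vs_ge alpha_gt0 rho_lt1
  l1_gt0 l2_gt0 l3_gt0 l4_gt0 l_eigen.
rewrite -BE in Bge.
have Blt : B < alpha / k ^+ 2 by rewrite BE gtrDr subr_lt0.
have := contraction_tradeoff k_gt1 alpha_gt0 Bge Blt phi0 phiG Gk.
set q := Num.sqrt _ in h3 * => ct.
have kn0 : k != 0 by rewrite gt_eqF.
have [u uE] : exists u, u = l3 / k by eexists.
have u0 : 0 < u by rewrite uE divr_gt0.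
have l3E : l3 = u * k by rewrite uE divfK.
have rhoE : 1 - alpha / k ^+ 2 + B = rho by rewrite BE; ring.
rewrite rhoE in ct.
have {}h2 : e2' <= sigma * e2 + L * (vs * e1 + T + beta * e4).
  by apply: le_trans h2 _; rewrite lerD2l ler_pM2l.
case: l_eigen => E1 E2 E3 E4; rewrite -BE in E3.
(* By the third eigenvector equation, the feedback term of [contraction_tradeoff] is exactly the
   total contribution of [G] to the other three errors. *)
have E3' : u * (B * G / k) = alpha * (l1 + L * l2 + l4) * G.
  have -> : u * (B * G / k) = B * l3 * G / k ^+ 2 by rewrite uE; field.
  by rewrite E3; field.
rewrite -uE.
have i1 := ler_wpM2l (ltW l1_gt0) h1.
have i2 := ler_wpM2l (ltW l2_gt0) h2.
have i3 := ler_wpM2l (ltW u0) h3.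
have i4 := ler_wpM2l (ltW l4_gt0) h4.
have i5 := ler_wpM2l (ltW u0) ct.
rewrite mulrDr E3' in i5.
have LmE : L * (e2 / mu) = k ^+ 2 * e2 by rewrite -kappaE; ring.
have c1 := congr1 (fun x => x * e1) E1.
have c2 := congr1 (fun x => x * e2) E2.
have c4 := congr1 (fun x => x * e4) E4.
rewrite /= in c1 c2 c4.
have c2' : alpha / mu * (l1 + L * l2 + l3 + l4) * e2 =
  alpha * (l1 + l3 + l4) * (e2 / mu) + alpha * l2 * (k ^+ 2 * e2).
  by rewrite -LmE; ring.
have uk : u * (k * (alpha * (k ^+ 2 * e1 + e2 / mu) + beta * e4)) =
  l3 * (alpha * (k ^+ 2 * e1 + e2 / mu) + beta * e4) by rewrite l3E; ring.
rewrite mulrDr uk in i3.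
have i2' : l2 * (sigma * e2 + L * (vs * e1 + T + beta * e4)) =
  l2 * sigma * e2 + L * l2 * (vs * e1 + alpha * (k ^+ 2 * e1 + G) + beta * e4)
  + alpha * l2 * (k ^+ 2 * e2) by rewrite -LmE /T; ring.
rewrite i2' in i2; rewrite c2' in c2; rewrite /T in i1 i4.
move: (e2 / mu) c2 i1 i3 i4 => v c2 i1 i3 i4.
clear - i1 i2 i3 i4 i5 c1 c2 c4.
lra.
Qed.

(** The four inequalities say that [Amat] maps [eps] strictly below itself; pairing with the
    positive left eigenvector gives [rho * (l . eps) < l . eps]. *)
Lemma left_eigen4_lt1 (R : realType)
    (mu L kappa vs sigma alpha beta rho l1 l2 l3 l4 eps1 eps2 eps3 eps4 : R) :
  let T := alpha * (kappa * (eps1 + eps3) + eps2 / mu) in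
  L / mu = kappa ->
  0 < l1 -> 0 < l2 -> 0 < l3 -> 0 < l4 ->
  0 < eps1 -> 0 < eps2 -> 0 < eps3 -> 0 < eps4 ->
  left_eigen4 mu L kappa vs sigma alpha beta rho l1 l2 l3 l4 ->
  sigma * eps1 + T + beta * eps4 < eps1 ->
  sigma * eps2 + L * (vs * eps1 + T + beta * eps4) < eps2 ->
  alpha * (kappa * eps1 + eps2 / mu) + beta * eps4 < alpha / kappa * eps3 ->
  vs * eps1 + T + beta * eps4 < eps4 ->
  rho < 1.
Proof.
move=> T kE l1p l2p l3p l4p e1p e2p e3p e4p [E1 E2 E3 E4] h1 h2 h3 h4.
have S0 : 0 < l1 * eps1 + l2 * eps2 + l3 * eps3 + l4 * eps4.
  by rewrite !addr_gt0 // mulr_gt0.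
rewrite -(ltr_pM2r S0) mul1r.
rewrite -(ltr_pM2l l1p) in h1; rewrite -(ltr_pM2l l2p) in h2.
rewrite -(ltr_pM2l l3p) in h3; rewrite -(ltr_pM2l l4p) in h4.
have c1 := congr1 (fun x => x * eps1) E1.
have c2 := congr1 (fun x => x * eps2) E2.
have c3 := congr1 (fun x => x * eps3) E3.
have c4 := congr1 (fun x => x * eps4) E4.
rewrite /= in c1 c2 c3 c4.
have LmE : L * (eps2 / mu) = kappa * eps2 by rewrite -kE; ring.
have c2' : alpha / mu * (l1 + L * l2 + l3 + l4) * eps2 =
  alpha * (l1 + l3 + l4) * (eps2 / mu) + alpha * l2 * (kappa * eps2).
  by rewrite -LmE; ring.
have h2E : l2 * (sigma * eps2 + L * (vs * eps1 + T + beta * eps4)) =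
  l2 * sigma * eps2 + L * l2 * (vs * eps1 + alpha * (kappa * (eps1 + eps3)) + beta * eps4)
  + alpha * l2 * (kappa * eps2) by rewrite -LmE /T; ring.
rewrite h2E in h2; rewrite c2' in c2; rewrite /T in h1 h4.
move: (eps2 / mu) c2 h1 h3 h4 => v c2 h1 h3 h4.
move: (alpha / kappa) c3 h3 => w c3 h3.
clear - h1 h2 h3 h4 c1 c2 c3 c4.
lra.
Qed.

(** * From the step-size conditions to linear convergence *)

Lemma mul_lt_of_lt_div (F : realFieldType) (x y a b e : F) : 0 < x -> 0 < e ->
  b < x / e * (y / x - a) -> a * x + b * e < y.
Proof.
move=> x0 e0; have -> : x / e * (y / x - a) = (y - a * x) / e.
  by field; rewrite !gt_eqF.
by rewrite ltr_pdivlMr // ltrBrDl.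
Qed.

Lemma fro_col4 (R : realType) (a b c d : R) : 0 <= a -> 0 <= b -> 0 <= c -> 0 <= d ->
  fro (\col_(k < 4) [:: a; b; c; d]`_k) <= a + b + c + d.
Proof.
move=> a0 b0 c0 d0; apply: fro_le_bound; first by rewrite !addr_ge0.
rewrite /frodot !big_ord_recl !big_ord0 !mxE /=.
have := (mulr_ge0 a0 b0, mulr_ge0 a0 c0, mulr_ge0 a0 d0).
have := (mulr_ge0 b0 c0, mulr_ge0 b0 d0, mulr_ge0 c0 d0).
move=> [[bc bd] cd] [[ab ac] ad]; lra.
Qed.

Theorem theorem1 (R : realType) (N p : nat)
  (f : 'I_N -> 'rV[R]_p -> R)
  (grad : 'I_N -> 'rV[R]_p -> 'rV[R]_p)
  (hess : 'I_N -> 'rV[R]_p -> 'M[R]_p)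
  (mu L : R) (xstar : 'rV[R]_p) (W : 'M[R]_N)
  (eps1 eps2 eps3 eps4 alpha beta : R) :
  (2 <= N)%N ->
  (* f_i twice differentiable, with gradient grad i and Hessian hess i *)
  (forall i x, differentiable (f i) x) ->
  (forall i x v, 'd (f i) x v = (v *m (grad i x)^T) 0 0) ->
  (forall i x, differentiable (grad i) x) ->
  (forall i x v, 'd (grad i) x v = v *m (hess i x)^T) ->
  0 < mu -> mu < L ->
  (* mu I <= hess f_i (x) <= L I *)
  (forall i x v, mu * fro v ^+ 2 <= quad (hess i x) v /\
                 quad (hess i x) v <= L * fro v ^+ 2) ->
  (* L-Lipschitz gradients *)
  (forall i x y, fro (grad i x - grad i y) <= L * fro (x - y)) ->
  (* xstar is the minimizer of f = (1/N) sum_i f_i *)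
  (forall x, (N%:R)^-1 * \sum_(i < N) f i xstar
             <= (N%:R)^-1 * \sum_(i < N) f i x) ->
  mixing_matrix W ->
  let vs := spec_norm (W - 1%:M) in
  let sigma := spec_norm (W - (N%:R)^-1 *: (const_mx 1 : 'M[R]_N)) in
  sigma < 1 ->
  let sigmab := 1 - sigma in
  let kappa := L / mu in
  0 < eps1 -> 0 < eps2 -> 0 < eps3 -> 0 < eps4 ->
  eps1 < sigmab * eps2 / (L * vs) ->
  eps1 < eps3 / kappa ^+ 2 - eps2 / (mu * kappa) ->
  eps1 < eps4 / vs ->
  let epst := kappa * (eps1 + eps3) + eps2 / mu in
  let epsb := L * kappa * (eps1 + eps3) + kappa * eps2 in
  0 < alpha ->
  alpha < 1 / kappa ->
  alpha < sigmab * eps1 / epst ->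
  alpha < (sigmab * eps2 - L * vs * eps1) / epsb ->
  alpha < (eps4 - vs * eps1) / epst ->
  0 < beta ->
  beta < epst / eps4 * (sigmab * eps1 / epst - alpha) ->
  beta < epsb / (L * eps4) * ((sigmab * eps2 - L * vs * eps1) / epsb - alpha) ->
  beta < alpha / eps4 * (eps3 / kappa - kappa * eps1 - eps2 / mu) ->
  beta < epst / eps4 * ((eps4 - vs * eps1) / epst - alpha) ->
  let rho := spectral_radius (Amat mu L kappa vs sigma alpha beta) in
  rho < 1 /\
  forall X0 : 'M[R]_(N, p),
    let e := evec W alpha beta grad hess X0 xstar in
    (fun t => fro (e t)) @ \oo --> (0 : R) /\
    exists C : R, forall t : nat, fro (e t) <= C * rho ^+ t.
Proof.
move=> N2 fdiff fgrad gdiff ghess mu_gt0 mu_lt_L quad_bound gLip xstar_min W_mix.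
move=> vs sigma sigma_lt1 sigmab kappa eps1_gt0 eps2_gt0 eps3_gt0 eps4_gt0 _ _ _.
move=> epst epsb alpha_gt0 alpha_lt _ _ _ beta_gt0 b1 b2 b3 b4 rho.
have N_gt0 : (0 < N)%N by exact: ltnW.
have L_gt0 : 0 < L by exact: lt_trans mu_lt_L.
have quad_ge i x v : mu * fro v ^+ 2 <= quad (hess i x) v by case: (quad_bound i x v).
have kappa_gt1 : 1 < kappa by rewrite ltr_pdivlMr // mul1r.
have kappa_gt0 : 0 < kappa by exact: lt_trans kappa_gt1.
have ak1 : alpha * kappa < 1 by rewrite -ltr_pdivlMr.
have alpha_lt1 : alpha < 1.
  by apply: lt_trans ak1; rewrite ltr_pMr.
have ak1' : alpha / kappa < 1.
  by rewrite ltr_pdivrMr // mul1r (lt_trans alpha_lt1).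
have vs_ge0 : 0 <= vs by exact: spec_norm_ge0.
have sigma_ge0 : 0 <= sigma by exact: spec_norm_ge0.
have vs_ge : 1 - sigma <= vs by exact: spec_norm_mix_ge.
have [r [l1 [l2 [l3 [l4 [r_gt0 [l1_gt0 l2_gt0 l3_gt0 l4_gt0] l_eigen rhoE]]]]]] :=
  perron_Amat mu_gt0 L_gt0 vs_ge0 sigma_ge0 alpha_gt0 ak1' beta_gt0.
have {rhoE} rhoE : rho = r by exact: rhoE.
move: rho rhoE => _ ->.
have epst_gt0 : 0 < epst by rewrite addr_gt0 ?divr_gt0 // mulr_gt0 // addr_gt0.
have epsb_gt0 : 0 < epsb.
  by rewrite addr_gt0 // mulr_gt0 ?addr_gt0 // mulr_gt0.
(* Cleared of denominators, the four bounds on [beta] are the four rows of [Amat] applied to [eps];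
   the second uses [epsb = L * epst]. *)
have r_lt1 : r < 1.
  have a1 := mul_lt_of_lt_div epst_gt0 eps4_gt0 b1.
  have a2 := mul_lt_of_lt_div epsb_gt0 (mulr_gt0 L_gt0 eps4_gt0) b2.
  have a4 := mul_lt_of_lt_div epst_gt0 eps4_gt0 b4.
  have a3 : alpha * (kappa * eps1 + eps2 / mu) + beta * eps4 < alpha / kappa * eps3.
    move: b3; rewrite mulrAC ltr_pdivlMr //.
    have -> : alpha / kappa * eps3 = alpha * (eps3 / kappa) by ring.
    move: (eps3 / kappa) (eps2 / mu) => u v; clear; lra.
  have epsbE : epsb = L * epst.
    by rewrite /epsb /epst /kappa; ring.
  apply: (left_eigen4_lt1 (erefl kappa) l1_gt0 l2_gt0 l3_gt0 l4_gt0 eps1_gt0 eps2_gt0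
    eps3_gt0 eps4_gt0 l_eigen _ _ a3); rewrite -/epst.
  - by move: a1; rewrite /sigmab; clear; move: epst => x; lra.
  - move: a2; rewrite epsbE /sigmab; clear; move: epst => x; lra.
  - by move: a4; clear; move: epst => x; lra.
split => // X0 e.
pose k := Num.sqrt kappa.
have kE : kappa = k ^+ 2 by rewrite sqr_sqrtr // ltW.
have k_gt1 : 1 < k by rewrite -sqrtr1 ltr_sqrt.
have k_gt0 : 0 < k by exact: lt_trans k_gt1.
pose X := Xs W alpha beta grad hess X0.
pose Xp := Xprev W alpha beta grad hess X0.
pose Y := Ys W alpha beta grad hess X0.
have XS t : X t.+1 = W *m X t - alpha *: Dmat hess (X t) (Y t) + beta *: (X t - Xp t).
  by rewrite /X /Y /Xp /Xs /Ys /Xprev /=; case: (state _ _ _ _ _ _ t) => [[]].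
have XpS t : Xp t.+1 = X t.
  by rewrite /X /Xp /Xs /Xprev /=; case: (state _ _ _ _ _ _ t) => [[]].
have YS t : Y t.+1 = W *m Y t + (Gmat grad (X t.+1) - Gmat grad (X t)).
  by rewrite /X /Y /Xs /Ys /=; case: (state _ _ _ _ _ _ t) => [[]].
have avgY t : avg (Y t) = avg (Gmat grad (X t)).
  elim: t => [//|t IH]; rewrite YS XS; exact: step_avg_y.
pose E1 t := fro (X t - consensus (X t)).
pose E2 t := fro (Y t - consensus (Y t)).
pose E4 t := fro (X t - Xp t).
pose phi t := opt_err f mu xstar (avg (X t)).
pose V t := l1 * E1 t + l2 * E2 t + l3 / k * phi t + l4 * E4 t.
have VS t : V t.+1 <= r * V t.
  have alpha_ge0 := ltW alpha_gt0; have beta_ge0 := ltW beta_gt0.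
  have ak2 : alpha * (L / mu) <= 2 by apply: le_trans (ltW ak1) _; rewrite ler1n.
  have kE' : L / mu = k ^+ 2 := kE.
  rewrite kE' in l_eigen.
  apply: (@lyapunov_step R mu L k vs sigma alpha beta r l1 l2 l3 l4 (E1 t) (E2 t) (E4 t)
    (phi t) (grad_err grad mu (avg (X t)))) => //.
  - exact: opt_err_ge0.
  - exact: (opt_err_le_grad N_gt0 fdiff fgrad gdiff ghess quad_ge).
  - exact: (grad_err_le_opt N_gt0 fdiff fgrad gLip).
  - rewrite /E1 XS -kE.
    exact: (step_x_dev N_gt0 quad_ge gLip mu_gt0 L_gt0 W_mix alpha_ge0 beta_ge0).
  - rewrite /E4 XpS XS -kE.
    exact: (step_x_diff N_gt0 quad_ge gLip mu_gt0 L_gt0 W_mix alpha_ge0 beta_ge0).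
  - rewrite /E2 /E4 YS XpS XS; exact: step_y_dev.
  - rewrite /phi XS -kE.
    exact: (step_opt_err N_gt0 fdiff fgrad gdiff ghess quad_ge gLip mu_gt0 L_gt0
      xstar_min W_mix alpha_ge0 beta_ge0 ak2).
have Vt t : V t <= V 0%N * r ^+ t.
  elim: t => [|t IH]; first by rewrite mulr1.
  by apply: le_trans (VS t) _; rewrite exprS mulrCA ler_pM2l.
(* Each error is at most [V t] divided by its weight, so the sum of the inverse weights bounds the
   norm of the error vector. *)
pose c := l1^-1 + l2^-1 + (l3 / k)^-1 + l4^-1.
have u_gt0 : 0 < l3 / k by rewrite divr_gt0.
have phi0 t : 0 <= phi t by exact: opt_err_ge0.
have eV t : fro (e t) <= c * V t.
  have a1 : 0 <= l1 * E1 t by rewrite mulr_ge0 ?fro_ge0 // ltW.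
  have a2 : 0 <= l2 * E2 t by rewrite mulr_ge0 ?fro_ge0 // ltW.
  have a3 : 0 <= l3 / k * phi t by rewrite mulr_ge0 // ltW.
  have a4 : 0 <= l4 * E4 t by rewrite mulr_ge0 ?fro_ge0 // ltW.
  have bnd (l x : R) : 0 < l -> l * x <= V t -> x <= l^-1 * V t.
    by move=> l0; rewrite mulrC -ler_pdivlMr // mulrC.
  have v1 : E1 t <= l1^-1 * V t.
    by apply: bnd => //; rewrite /V -!addrA lerDl !addr_ge0.
  have v2 : E2 t <= l2^-1 * V t.
    by apply: bnd => //; rewrite /V -!addrA addrCA lerDl !addr_ge0.
  have v3 : phi t <= (l3 / k)^-1 * V t.
    by apply: bnd => //; rewrite /V addrAC lerDr !addr_ge0.
  have v4 : E4 t <= l4^-1 * V t.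
    by apply: bnd => //; rewrite /V lerDr !addr_ge0.
  have v3' : e3 W alpha beta grad hess X0 xstar t <= (l3 / k)^-1 * V t.
    by apply: le_trans v3; exact: (dist_le_opt_err N_gt0 fdiff fgrad gdiff ghess quad_ge gLip).
  have e0 : 0 <= e3 W alpha beta grad hess X0 xstar t.
    by rewrite mulr_ge0 ?sqrtr_ge0 ?fro_ge0.
  apply: le_trans (fro_col4 (fro_ge0 _) (fro_ge0 _) e0 (fro_ge0 _)) _.
  by rewrite /c !mulrDl; apply: lerD v4; apply: lerD v3'; exact: lerD v1 v2.
have V0 : 0 <= V 0%N.
  by rewrite /V; do !apply: addr_ge0; apply: mulr_ge0; rewrite ?fro_ge0 ?phi0 // ltW.
have c0 : 0 <= c by rewrite /c; do !apply: addr_ge0; rewrite invr_ge0 ltW.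
have eb t : fro (e t) <= (c * V 0%N) * r ^+ t.
  by apply: le_trans (eV t) _; rewrite -mulrA ler_wpM2l.
split; last by exists (c * V 0%N).
apply: (@squeeze_cvgr _ _ _ _ (fun=> 0) (fun t => (c * V 0%N) * r ^+ t)).
- by near=> t; rewrite fro_ge0 eb.
- exact: cvg_cst.
- rewrite -[X in _ --> X](mulr0 (c * V 0%N)); apply: cvgMl_tmp.
  by apply: cvg_expr; rewrite gtr0_norm.
Unshelve. all: by end_near.
Qed.
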